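(* Let $\beta(n,d)=\dim_{\mathbb{Z}_3}\tilde H_d(\mathsf{M}_n;\mathbb{Z}_3)$. Then $\beta(3,0)=2$, $\beta(6,1)=16$, $\beta(9,2)=50$, $\beta(12,3)=56$, and \[\beta(3r+3,r)\le\frac{6r^3+9r^2+5r}{2}-73\quad\text{for all } r\ge 4.\]
   Context: $\mathsf{M}_n$ is the matching complex of the complete graph on $[n]=\{1,\dots,n\}$ (vertices: edges; faces: matchings). $\tilde H$ denotes reduced simplicial homology. *)

(* Defs.v *)
From HB Require Import structures.
From mathcomp Require Import all_boot all_order all_algebra.

Set Implicit Arguments.
Unset Strict Implicit.
Unset Printing Implicit Defensive.

Import Order.TTheory GRing.Theory Num.Theory.
Local Open Scope ring_scope.

(** A finite simplicial complex is a downward closed family [K] of subsets of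
    an ambient finite type [V]; its vertices are the [v] with [[set v] \in K],
    and a face of dimension [d] has [d.+1] elements. *)
Definition simplicial_complex (V : finType) (K : {set {set V}}) : Prop :=
  forall s t : {set V}, s \in K -> t \subset s -> t \in K.

Section Homology.
Variables (F : fieldType) (V : finType).

(** The free vector space on all subsets of [V], the empty set included; the
    chain groups of a complex are subspaces of it. *)
Definition chain : vectType F := {ffun {set V} -> F^o}.

Definition face_chain (s : {set V}) : chain := [ffun t => (t == s)%:R].

(** Faces are oriented by the order of [enum V]: [face_pos s v] is the rank
    of [v] among the elements of [s]. *)
Definition face_pos (s : {set V}) (v : V) : nat :=
  #|[set u in s | (enum_rank u < enum_rank v)%N]|.

Definition face_boundary (s : {set V}) : chain :=
  \sum_(v in s) (-1) ^+ face_pos s v *: face_chain (s :\ v).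

Definition boundary_fun (c : chain) : chain :=
  \sum_(s : {set V}) c s *: face_boundary s.

Fact boundary_fun_is_linear : linear boundary_fun.
Proof.
move=> a c1 c2; rewrite /boundary_fun scaler_sumr -big_split /=.
by apply: eq_bigr => s _; rewrite !ffunE scalerDl scalerA.
Qed.

HB.instance Definition _ :=
  GRing.isLinear.Build F chain chain *:%R boundary_fun boundary_fun_is_linear.

Definition boundary : 'End(chain) := linfun boundary_fun.

Definition chains (K : {set {set V}}) (d : nat) : {vspace chain} :=
  <<[seq face_chain s | s in [set s in K | #|s| == d.+1]]>>%VS.

(** In degree 0, [boundary] maps a vertex to [face_chain set0], i.e. it is the
    augmentation; hence these are the cycles of the reduced complex. *)
Definition cycles (K : {set {set V}}) (d : nat) : {vspace chain} :=
  (chains K d :&: lker boundary)%VS.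

Definition boundaries (K : {set {set V}}) (d : nat) : {vspace chain} :=
  (boundary @: chains K d.+1)%VS.

(** The dimension of the quotient [cycles K d / boundaries K d]; the
    subtraction is exact by [boundaries_sub_cycles]. *)
Definition reduced_betti (K : {set {set V}}) (d : nat) : nat :=
  (\dim (cycles K d) - \dim (boundaries K d))%N.

Lemma boundary_face s : boundary (face_chain s) = face_boundary s.
Proof.
rewrite lfunE /= /boundary_fun (bigD1 s) //= ffunE eqxx scale1r big1 ?addr0 //.
by move=> t /negbTE ts; rewrite ffunE ts scale0r.
Qed.

Lemma face_posD1 (s : {set V}) u v : u \in s ->
  face_pos s v = ((enum_rank u < enum_rank v) + face_pos (s :\ u) v)%N.
Proof.
move=> us; rewrite /face_pos (cardsD1 u) inE us /=; congr (_ + _)%N.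
by apply: eq_card => w; rewrite !inE andbA.
Qed.

Lemma boundary_boundary_face s : boundary (face_boundary s) = 0.
Proof.
rewrite /face_boundary linear_sum /=.
under eq_bigr => v _ do
  rewrite linearZ /= boundary_face /face_boundary scaler_sumr.
pose f u v : chain := (-1) ^+ (face_pos s u + face_pos (s :\ u) v)
                      *: face_chain (s :\ u :\ v).
pose r (u v : V) := (enum_rank u < enum_rank v)%N.
rewrite (eq_bigr (fun u => \sum_(v in s :\ u | r u v) f u v
                         + \sum_(v in s :\ u | ~~ r u v) f u v)); last first.
  move=> u us; rewrite (bigID (r u)) /=.
  by congr (_ + _); apply: eq_bigr => v _; rewrite /f scalerA exprD.
rewrite big_split /=.
rewrite [X in _ + X](exchange_big_dep (mem s)) /=; last first.
  by move=> u v _; rewrite !inE => /andP[/andP[]].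
rewrite -big_split big1 //= => u us.
rewrite [X in _ + X](eq_bigl (fun v => (v \in s :\ u) && r u v)); last first.
  move=> v; rewrite !inE us /= andbT eq_sym andbCA -andbA /r -leqNgt leq_eqVlt.
  case: (eqVneq v u) => [//|vu] /=; congr (_ && _).
  suff /negbTE -> : enum_rank u != enum_rank v :> nat by [].
  by apply: contra vu => /eqP/val_inj/enum_rank_inj ->.
rewrite -big_split big1 //= => v /andP[]; rewrite !inE => /andP[vu vs] ruv.
rewrite /f (face_posD1 v us) (face_posD1 u vs).
rewrite -/(r u v) -/(r v u) ruv.
have -> : r v u = false by apply/negbTE; rewrite /r -leqNgt ltnW.
have -> : s :\ v :\ u = s :\ u :\ v by rewrite !setDDl setUC.
rewrite -scalerDl add0n add1n addSn exprS mulN1r.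
by rewrite [X in - (-1) ^+ X]addnC addrN scale0r.
Qed.

Lemma boundaries_sub_cycles K d :
  simplicial_complex K -> (boundaries K d <= cycles K d)%VS.
Proof.
move=> Kcl; rewrite /boundaries limg_span; apply/span_subvP => c.
case/mapP => _ /mapP[s sK ->] ->; rewrite mem_enum inE in sK.
case/andP: sK => sK /eqP sd.
rewrite boundary_face memv_cap memv_ker boundary_boundary_face eqxx andbT.
apply: memv_suml => v vs; apply/memvZ/memv_span/map_f.
rewrite mem_enum inE (Kcl _ _ sK) ?subsetDl //=.
by move: sd; rewrite (cardsD1 v) vs add1n => -[->].
Qed.

End Homology.

Definition complete_edges (n : nat) : {set {set 'I_n}} :=
  [set e : {set 'I_n} | #|e| == 2].

Definition matching_complex (n : nat) : {set {set {set 'I_n}}} :=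
  [set M : {set {set 'I_n}} | (M \subset complete_edges n) && trivIset M].

Lemma matching_complexP n : simplicial_complex (matching_complex n).
Proof.
move=> M N; rewrite !inE => /andP[Me Mt] NM.
by rewrite (subset_trans NM Me) (trivIsetS NM Mt).
Qed.

Definition beta (n d : nat) : nat := reduced_betti 'F_3 (matching_complex n) d.

(* Main.v *)
(* Let b_d(E) be the d-th reduced Betti number of the complex of matchings
   with edges in E. Deleting an edge e gives b_d(E) <= b_d(E - e) +
   b_{d-1}(edges of E disjoint from e), and an edge disjoint from all others
   makes the complex a cone. Start from the complete graph on n vertices and
   remove an edge ab, then, for a third vertex w, the edges at w avoiding a and
   b, then the edges at a and at b avoiding w. With A(n,q) and B(n,q) the Betti
   numbers in degree q - 2 of K_n and of K_n minus an edge, this yields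
     A(n,q+1) <= A(n-2,q) + B(n,q+1),
     B(n,q+1) <= (n-3) B(n-2,q) + (n-3)(n-4) A(n-5,q-1) + A(n-3,q).
   Hence A(n,q) = 0 if n >= 3q - 1, then A(3q-2,q) <= 1 for q >= 3 because
   A(7,3) = 1, and finally beta(3r+3,r) <= beta(3r,r-1) + 9 r^2 + 1, which sums
   to the cubic polynomial starting from beta(12,3) = 56.

   In the exact values the vanishing above determines all the boundary ranks
   involved but one, which is found by a sparse elimination over Z/3. For M_12
   this rank is 39479; pairing the 12 vertices into 6 nodes, the chains split
   under the group (Z/2)^6 of swaps inside the nodes, the isotypic part of a
   character is spanned by the projections of matchings in normal form, and as
   their numbers add up to the number of matchings they form bases. Permuting
   the nodes shows that the rank on an isotypic part depends only on the number
   of nodes where the character is nontrivial. *)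
Require Import Defs.
From HB Require Import structures.
From mathcomp Require Import all_boot all_order all_algebra.
From mathcomp Require Import zify lra.

Set Implicit Arguments.
Unset Strict Implicit.
Unset Printing Implicit Defensive.

Import Order.TTheory GRing.Theory Num.Theory.

(** * Sparse columns over Z/3 and their elimination *)

(* Columns have coefficients in Z/3: the flag [true] stands for -1, and absent
   keys have coefficient 0. *)
Definition key := seq bool.
Definition column := seq (key * bool).

Fixpoint kcmp (k l : key) : comparison :=
  match k, l with
  | [::], [::] => Eq
  | [::], _ => Lt
  | _, [::] => Gt
  | a :: k', b :: l' =>
    match a, b with
    | false, true => Lt
    | true, false => Gt
    | _, _ => kcmp k' l'
    end
  end.

(** Merges two columns into [c + (-1)^s p]. Equal keys with opposite signs cancel; with equal signs
    they yield the opposite sign, as 1 + 1 = -1 in Z/3. The inner [fix] allows recursion on either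
    list. *)
Fixpoint cadd (s : bool) (c : column) : column -> column :=
  fix cadds (p : column) :=
    match c, p with
    | [::], [::] => [::]
    | _, [::] => c
    | [::], (l, t) :: p' => (l, s (+) t) :: cadds p'
    | (k, u) :: c', (l, t) :: p' =>
      match kcmp k l with
      | Lt => (k, u) :: cadd s c' p
      | Gt => (l, s (+) t) :: cadds p'
      | Eq => if u (+) (s (+) t) then cadd s c' p'
              else (k, ~~ u) :: cadd s c' p'
      end
    end.

Inductive trie := Leaf | Node of option column & trie & trie.

Fixpoint tfind (k : key) (t : trie) : option column :=
  match t with
  | Leaf => None
  | Node o l r =>
    match k with
    | [::] => o
    | b :: k' => tfind k' (if b then r else l)
    end
  end.

Fixpoint tinsert (k : key) (c : column) (t : trie) : trie :=
  match k with
  | [::] => match t with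
            | Leaf => Node (Some c) Leaf Leaf
            | Node _ l r => Node (Some c) l r
            end
  | b :: k' =>
    match t with
    | Leaf => if b then Node None Leaf (tinsert k' c Leaf)
              else Node None (tinsert k' c Leaf) Leaf
    | Node o l r => if b then Node o l (tinsert k' c r)
                    else Node o (tinsert k' c l) r
    end
  end.

(** The pivots in [T] have leading coefficient 1, so that adding [-(-1)^s p] kills the leading term.
    [None] means that the fuel ran out. *)
Fixpoint reduce (fuel : nat) (T : trie) (c : column) : option column :=
  match c with
  | [::] => Some [::]
  | (k, s) :: _ =>
    match tfind k T with
    | None => Some c
    | Some p => if fuel is n.+1 then reduce n T (cadd (~~ s) c p) else None
    end
  end.

Fixpoint ksorted (c : column) : bool :=
  match c with
  | (k, _) :: ((l, _) :: _) as c' =>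
    if kcmp k l is Lt then ksorted c' else false
  | _ => true
  end.

(** A nonzero remainder is scaled to leading coefficient 1 and becomes a pivot. Its sortedness is
    tested at run time instead of being carried as an invariant of [cadd]; a failed test gives
    [None]. *)
Fixpoint eliminate (fuel : nat) (T : trie) (r : nat) (cs : seq column) : option nat :=
  match cs with
  | [::] => Some r
  | c :: cs' =>
    match reduce fuel T c with
    | None => None
    | Some [::] => eliminate fuel T r cs'
    | Some (((k, s) :: _) as c1) =>
      let c2 := cadd s [::] c1 in
      if ksorted c2 then eliminate fuel (tinsert k c2 T) r.+1 cs' else None
    end
  end.

(** * Words for matchings and the matrices of the isotypic parts *)

(* A word encodes a matching up to swaps of the two points of a node: a letter
   [(i, j)] is an edge joining a point of node [i] to a point of node [j]. *)
Definition letter := (nat * nat)%type.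
Definition word := seq letter.

Definition occ (i : nat) (w : word) : bool := has (fun a => (i == a.1) || (i == a.2)) w.

Fixpoint deg (i : nat) (w : word) : nat :=
  if w is a :: w' then ((i == a.1) + (i == a.2) + deg i w')%N else 0%N.

Definition letters (n : nat) : seq letter :=
  [seq (i, j) | i <- iota 0 n, j <- iota i (n - i)].

Definition letter_le (a b : letter) := (a.1 < b.1) || ((a.1 == b.1) && (a.2 <= b.2)).

Definition capacity (dbl : bool) := if dbl then 2 else 1.

(* The character is nontrivial at the nodes below [k]. A letter [(i, i)] with
   [i < k], or a letter repeated whose two nodes have the same type, is left
   out: some swap then maps the matching to itself with sign -1, so that its
   isotypic projection vanishes. *)
Definition extends (dbl : bool) (k : nat) (a : letter) (w : word) : bool :=
  [&& (if w is b :: _ then letter_le a b && ~~ ((a == b) && ((a.1 < k) == (a.2 < k)))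
       else true),
      (if a.1 == a.2 then ~~ (a.1 < k) else true),
      deg a.1 (a :: w) <= capacity dbl & deg a.2 (a :: w) <= capacity dbl].

Fixpoint prenormal (n : nat) (dbl : bool) (k m : nat) : seq word :=
  if m is m'.+1 then
    let W := prenormal n dbl k m' in
    flatten [seq [seq a :: w | w <- W & extends dbl k a w] | a <- letters n]
  else [:: [::]].

(** The swap at a node missed by the matching fixes it; if the character is -1 on this swap, the
    isotypic projection vanishes. *)
Definition meets_below (k : nat) (w : word) := all (fun i => occ i w) (iota 0 k).

Definition normal (n : nat) (dbl : bool) (k m : nat) : seq word :=
  [seq w <- prenormal n dbl k m | meets_below k w].

(** When [a] is deleted, an earlier edge sharing a node with it is moved to the other point by the
    swap there; the sign is the character of these swaps. *)
Definition deletion_sign (k : nat) (a : letter) (w : word) : bool :=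
  ((a.1 < k) && occ a.1 w) (+) ((a.2 < k) && occ a.2 w).

(** [pre] is the part already passed, in reverse order, and [s] the alternating sign of the
    position. *)
Fixpoint deletion_terms (k : nat) (pre : word) (s : bool) (w : word) : seq (bool * word) :=
  if w is a :: w' then
    (s (+) deletion_sign k a pre, catrev pre w') :: deletion_terms k (a :: pre) (~~ s) w'
  else [::].

(** Each number is written in unary and closed by [false], so that the word can be read back from
    its key. *)
Definition encode (w : word) : key :=
  flatten [seq nseq a.1 true ++ false :: nseq a.2 true ++ [:: false] | a <- w].

Definition boundary_column (k : nat) (w : word) : column :=
  foldr (fun p c => if meets_below k p.2 then cadd false c [:: (encode p.2, p.1)] else c)
    [::] (deletion_terms k [::] false w).

Definition isotypic_rank (n : nat) (dbl : bool) (k m : nat) : option nat :=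
  eliminate 2000 Leaf 0 (rev [seq boundary_column k w | w <- normal n dbl k m.+1]).

(** * Keys, tries and triangular families *)

Lemma kcmp_eq k l : kcmp k l = Eq -> k = l.
Proof. by elim: k l => [|a k IH] [|b l] //=; case: a b => [] [] // /IH->. Qed.

Definition klt : rel key := fun k l => ((k : seqlexi bool) < l)%O.

Lemma klt_trans : transitive klt.
Proof. by move=> l k m; apply: lt_trans. Qed.

Lemma kcmp_lt k l : kcmp k l = Lt -> klt k l.
Proof.
rewrite /klt.
elim: k l => [|a k IH] [|b l] //=; rewrite ltxi_cons.
by case: a b => [] [] //= /IH ->.
Qed.

Lemma tfind_leaf k : tfind k Leaf = None.
Proof. by case: k. Qed.

Lemma tfind_insert k l c t : tfind k (tinsert l c t) = if k == l then Some c else tfind k t.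
Proof.
elim: l k t => [|b l IH] k t.
  by case: t k => [|o t u] [|[] k] //=; rewrite ?tfind_leaf.
by case: t k b => [|o t u] [|[] k] [] //=; rewrite ?tfind_leaf // IH ?tfind_leaf.
Qed.

Local Open Scope ring_scope.

(** The later vectors span a subspace of the kernel of [phi a], which the vector of [a] avoids. *)
Lemma free_triangular (F : fieldType) (T : eqType) (vT : vectType F) (v : T -> vT)
    (phi : T -> 'Hom(vT, F^o)) (r : seq T) :
    {in r, forall a, phi a (v a) != 0} ->
    pairwise (fun a b => phi a (v b) == 0) r ->
  free (map v r).
Proof.
elim: r => [|a r IH] nz /=; first by rewrite nil_free.
case/andP=> /allP za pr; rewrite free_cons IH ?andbT //; last first.
  by move=> b br; apply: nz; rewrite inE br orbT.
apply: contra (nz a (mem_head _ _)) => va.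
suff /subvP/(_ _ va) : (<<map v r>> <= lker (phi a))%VS by rewrite memv_ker.
by apply/span_subvP => _ /mapP[b br ->]; rewrite memv_ker za.
Qed.

(** * Sparse elimination over a field of characteristic 3 *)

Section Elimination.
Variables (F : fieldType) (F3 : (3 : F) = 0) (vT : vectType F) (vec : key -> vT).

Definition ceval (c : column) : vT := \sum_(p <- c) (-1) ^+ p.2 *: vec p.1.

Lemma ceval_cons p c : ceval (p :: c) = (-1) ^+ p.2 *: vec p.1 + ceval c.
Proof. by rewrite /ceval big_cons. Qed.

Lemma ceval_nil : ceval [::] = 0.
Proof. by rewrite /ceval big_nil. Qed.

Let one_one : 1 + 1 = -1 :> F.
Proof. by apply/eqP; rewrite -subr_eq0 opprK -F3 mulrSr mulr2n. Qed.

Lemma cadd_nil s l t p : cadd s [::] ((l, t) :: p) = (l, s (+) t) :: cadd s [::] p.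
Proof. by []. Qed.

Lemma cadd_cons s k u c l t p : cadd s ((k, u) :: c) ((l, t) :: p) =
  match kcmp k l with
  | Lt => (k, u) :: cadd s c ((l, t) :: p)
  | Gt => (l, s (+) t) :: cadd s ((k, u) :: c) p
  | Eq => if u (+) (s (+) t) then cadd s c p else (k, ~~ u) :: cadd s c p
  end.
Proof. by []. Qed.

Lemma ceval_cadd s c p : ceval (cadd s c p) = ceval c + (-1) ^+ s *: ceval p.
Proof.
elim: c p => [|[k u] c IHc]; elim=> [|[l t] p IHp].
- by rewrite /= ceval_nil scaler0 addr0.
- rewrite cadd_nil !ceval_cons IHp ceval_nil !add0r.
  by rewrite scalerDr scalerA -signr_addb.
- by rewrite /= ceval_nil scaler0 addr0.
rewrite cadd_cons; case Ekl: (kcmp k l).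
- have {Ekl} <- := kcmp_eq Ekl.
  rewrite !ceval_cons scalerDr scalerA -signr_addb addrACA -scalerDl /=.
  case: ifP => ust; rewrite ?ceval_cons IHc.
    suff -> : (-1) ^+ u + (-1) ^+ (s (+) t) = 0 :> F by rewrite scale0r add0r.
    by clear IHp; move: ust; case: u (s (+) t) => [] [] //= _; rewrite ?subrr ?addNr.
  congr (_ *: _ + _).
  clear IHp; move: ust; case: u (s (+) t) => [] [] //= _; rewrite ?expr0 ?expr1 ?one_one //.
  by rewrite -opprD one_one opprK.
- by rewrite !ceval_cons IHc ceval_cons addrA.
rewrite ceval_cons IHp !ceval_cons scalerDr scalerA -signr_addb.
by rewrite addrCA.
Qed.

Definition lead (c : column) : key := head [::] (map fst c).

Variables (Ks : seq key) (Ks_free : free (map vec Ks)).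

Definition over (c : column) := all (fun p => p.1 \in Ks) c.

Definition wf (c : column) : bool :=
  [&& (if c is (_, s) :: _ then ~~ s else false), ksorted c & over c].

Lemma over_cadd s c p : over c -> over p -> over (cadd s c p).
Proof.
elim: c p => [|[k u] c IHc]; elim=> [|[l t] p IHp] //.
  by rewrite cadd_nil /= => oc /andP[-> /(IHp oc)].
rewrite cadd_cons /= => /andP[kK oc] /andP[lK op].
case: (kcmp k l); last by rewrite /= lK IHp //= kK.
  by case: ifP => _; rewrite /= ?kK IHc.
by rewrite /= kK IHc //= lK.
Qed.

Definition kcoord_fun (k : key) (v : vT) : F^o :=
  if insub (index k Ks) is Some i then coord (in_tuple (map vec Ks)) i v else 0.

Fact kcoord_fun_is_linear k : linear (kcoord_fun k).
Proof.
move=> a u v; rewrite /kcoord_fun; case: insubP => [i _ _|_]; last by rewrite scaler0 addr0.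
by rewrite linearD linearZ.
Qed.

HB.instance Definition _ k :=
  GRing.isLinear.Build F vT F^o *:%R (kcoord_fun k) (kcoord_fun_is_linear k).

Definition kcoord k : 'Hom(vT, F^o) := linfun (kcoord_fun k).

Lemma kcoordE k l : k \in Ks -> l \in Ks -> kcoord k (vec l) = ((k == l)%:R : F).
Proof.
move=> kK lK; have idx k' : k' \in Ks -> (index k' Ks < size (map vec Ks))%N.
  by rewrite size_map index_mem.
rewrite lfunE /= /kcoord_fun (insubT (fun i => i < size (map vec Ks))%N (idx k kK)).
have -> : vec l = (in_tuple (map vec Ks))`_(Ordinal (idx l lK)).
  by rewrite /= (nth_map [::]) ?index_mem // nth_index.
rewrite coord_free //; congr (_%:R); rewrite -val_eqE /=; congr (nat_of_bool _).
by apply/eqP/eqP => [/(congr1 (nth [::] Ks))|->]; rewrite ?nth_index.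
Qed.

Lemma kcoord_wf k c : over c -> k \in Ks -> all (fun p => klt k p.1) c ->
  kcoord k (ceval c) = 0.
Proof.
move=> /allP oc kK /allP lc; rewrite /ceval linear_sum big_seq big1 // => p pc.
rewrite linearZ /= kcoordE ?oc // (_ : k == p.1 = false) ?scaler0 //.
exact: lt_eqF (lc p pc).
Qed.

Lemma ksorted_lead k s c : ksorted ((k, s) :: c) ->
  all (fun p => klt k p.1) c.
Proof.
elim: c k s => [//|[l t] c IH] k s /=; case E: (kcmp k l) => // H.
rewrite kcmp_lt //=; apply/allP => p /(allP (IH _ t H))  lp; apply: klt_trans lp; exact: kcmp_lt.
Qed.

(** Sorted by leading key, the columns are triangular for the coordinates at their leading keys. *)
Lemma free_wf (P : seq column) : all wf P -> uniq (map lead P) -> free (map ceval P).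
Proof.
pose le (c p : column) := (lead c <= lead p :> seqlexi bool)%O.
move=> wfP uP; pose Q := sort le P.
have PQ : perm_eq Q P by apply/permPl/perm_sort.
rewrite -(perm_free (perm_map _ PQ)).
have {wfP} wfQ : all wf Q by rewrite (perm_all _ PQ).
have {uP} uQ : uniq (map lead Q) by rewrite (perm_uniq (perm_map _ PQ)).
have sQ : sorted le Q by apply: sort_sorted => c p; apply: le_total.
have le_tr : transitive le by move=> c p q; apply: le_trans.
clearbody Q; apply: (free_triangular (phi := fun c => kcoord (lead c))).
  move=> c /(allP wfQ) /and3P[]; case: c => [//|[k [//|]] c] _ sc /andP[/= kK oc].
  rewrite /lead /= ceval_cons linearD linearZ /= kcoordE // eqxx.
  by rewrite (kcoord_wf oc kK (ksorted_lead sc)) addr0 expr0 scale1r oner_neq0.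
move: sQ wfQ uQ {P PQ}; rewrite (sorted_pairwise le_tr).
elim: Q => //= c Q IH /andP[cQ sQ] /andP[wc wQ] /andP[cNQ uQ]; rewrite IH // andbT.
apply/allP => p pQ; have := allP wQ p pQ; have := allP cQ p pQ; rewrite /le.
case/and3P: wc; case: c {cQ} cNQ => [//|[k s] c] cNQ _ _ /andP[/= kK _] kp.
case: p pQ kp => [|[l t] p] pQ kp /and3P[//= _ sp /andP[/= lK op]].
have kl : klt k l.
  rewrite /klt lt_neqAle kp andbT; apply: contraNneq cNQ => ->.
  by apply/mapP; exists ((l, t) :: p).
rewrite kcoord_wf //= ?lK ?op ?kl //=.
by apply/allP => q /(allP (@ksorted_lead l t p sp)) lq; exact: (klt_trans kl lq).
Qed.

Definition compat (T : trie) (P : seq column) := forall k p,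
  tfind k T = Some p -> p \in P /\ lead p = k.

Lemma reduceP fuel T P c c1 : compat T P -> all wf P -> over c ->
    reduce fuel T c = Some c1 ->
  [/\ over c1, ceval c1 - ceval c \in <<map ceval P>>%VS &
      c1 = [::] \/ tfind (lead c1) T = None].
Proof.
move=> TP wP; elim: fuel c => [|n IH] [|[k s] c] oc /=.
- by case=> <-; rewrite subrr mem0v; split=> //; left.
- by case Ek: (tfind k T) => //= -[<-]; rewrite subrr mem0v; split=> //; right.
- by case=> <-; rewrite subrr mem0v; split=> //; left.
case Ek: (tfind k T) => [p|]; last first.
  by case=> <-; rewrite subrr mem0v; split=> //; right.
have [pP _] := TP k p Ek; have /and3P[_ _ op] := allP wP p pP.
case/(IH _ (over_cadd (~~ s) oc op)) => oc1 Ec1 Tc1.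
split=> //; have -> : ceval c1 - ceval ((k, s) :: c) =
  (ceval c1 - ceval (cadd (~~ s) ((k, s) :: c) p)) + (-1) ^+ (~~ s) *: ceval p.
  by rewrite ceval_cadd opprD addrA subrK.
by rewrite memvD // memvZ // memv_span // map_f.
Qed.

(** Loop invariant: [P] lists the pivots stored in [T], they are free, and the joint span of the
    pivots and the remaining columns stays the same. *)
Lemma eliminateP fuel T P cs r : compat T P -> (forall p, p \in P -> tfind (lead p) T = Some p) ->
    all wf P -> uniq (map lead P) -> all over cs ->
    eliminate fuel T (size P) cs = Some r ->
  \dim (<<map ceval P>> + <<map ceval cs>>) = r.
Proof.
elim: cs T P => [|c cs IH] T P TP PT wP uP /=.
  move=> _ [<-]; rewrite span_nil addv0 -(size_map ceval); apply/eqP.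
  exact: free_wf.
case/andP=> oc ocs; case Ec1: (reduce fuel T c) => [c1|//].
have [oc1 Dc1 Tc1] := reduceP TP wP oc Ec1.
(* A column may be replaced by its remainder, since the two differ by a combination of pivots. *)
have spanE : (<<map ceval P>> + <<map ceval (c :: cs)>> =
    (<[ceval c1]> + <<map ceval P>>) + <<map ceval cs>>)%VS.
  rewrite /= span_cons addvA; congr (_ + _)%VS; rewrite addvC; apply/eqP.
  rewrite eqEsubv !subv_add !addvSr -!memvE /= !andbT; apply/andP; split.
    have -> : ceval c = ceval c1 - (ceval c1 - ceval c) by rewrite subKr.
    exact: memvB (subvP (addvSl _ _) _ (memv_line _)) (subvP (addvSr _ _) _ Dc1).
  have -> : ceval c1 = ceval c + (ceval c1 - ceval c) by rewrite addrC subrK.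
  exact: memvD (subvP (addvSl _ _) _ (memv_line _)) (subvP (addvSr _ _) _ Dc1).
rewrite /= in spanE; rewrite spanE {spanE}.
case: c1 oc1 Tc1 {Dc1 Ec1} => [|[k s] c1] oc1 Tc1.
  move=> H; rewrite ceval_nil add0v; exact: IH H.
set c2 := cadd s [::] ((k, s) :: c1).
case: ifP => // sc2 H.
case: Tc1 => [//|]; rewrite /lead /= => Tk.
have Ec2 : c2 = (k, false) :: behead c2 by rewrite /c2 cadd_nil addbb.
have lc2 : lead c2 = k by rewrite Ec2.
have wc2 : wf c2.
  rewrite /wf sc2 over_cadd // andbT Ec2 //.
have c2span : (<[ceval ((k, s) :: c1)]> = <[ceval c2]>)%VS.
  rewrite ceval_cadd ceval_nil add0r; apply/eqP; rewrite eqEsubv -!memvE.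
  rewrite [X in _ && X]memvZ ?memv_line // andbT.
  by rewrite -[X in X \in _](signrZK s) memvZ ?memv_line.
rewrite c2span -span_cons; apply: (IH _ (c2 :: P) _ _ _ _ _ H) => //=.
- move=> l p; rewrite tfind_insert; case: eqVneq => [-> [<-]|lk /TP[pP lp]].
    by rewrite mem_head.
  by rewrite inE pP orbT.
- move=> p; rewrite inE tfind_insert => /predU1P[->|pP]; first by rewrite lc2 eqxx.
  by case: eqVneq => [lk|_]; [have := PT p pP; rewrite lk Tk | apply: PT].
- by rewrite wc2.
rewrite lc2 uP andbT; apply/negP => /mapP[p pP kp].
by have := PT p pP; rewrite -kp Tk.
Qed.

Lemma eliminate_dim fuel cs r : all over cs -> eliminate fuel Leaf 0 cs = Some r ->
  \dim <<map ceval cs>> = r.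
Proof.
move=> ocs /(eliminateP (P := [::])) /=; rewrite span_nil add0v; apply=> //.
by move=> k p; rewrite tfind_leaf.
Qed.

End Elimination.

(** * Cones and push-forwards of chains *)

Section LinearExtension.
Variables (F : fieldType) (V : finType) (W : vectType F).
Implicit Types f : {set V} -> W.

Definition lext_fun f (c : chain F V) : W := \sum_s c s *: f s.

Fact lext_fun_is_linear f : linear (lext_fun f).
Proof.
move=> a c1 c2; rewrite /lext_fun scaler_sumr -big_split /=.
by apply: eq_bigr => s _; rewrite !ffunE scalerDl scalerA.
Qed.

HB.instance Definition _ f :=
  GRing.isLinear.Build F (chain F V) W *:%R (lext_fun f) (lext_fun_is_linear f).

Definition lext f : 'Hom(chain F V, W) := linfun (lext_fun f).

Lemma lext_face f s : lext f (face_chain F s) = f s.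
Proof.
rewrite lfunE /= /lext_fun (bigD1 s) //= ffunE eqxx scale1r big1 ?addr0 //.
by move=> t /negbTE ts; rewrite ffunE ts scale0r.
Qed.

Lemma chain_sum (c : chain F V) : c = \sum_s c s *: face_chain F s.
Proof.
apply/ffunP => t; rewrite sum_ffunE (bigD1 t) //= big1 ?addr0 => [|s /negbTE st].
  by rewrite !ffunE eqxx /GRing.scale /= mulr1.
by rewrite !ffunE eq_sym st /GRing.scale /= mulr0.
Qed.

Lemma eq_on_faces (f g : 'Hom(chain F V, W)) :
  (forall s, f (face_chain F s) = g (face_chain F s)) -> f =1 g.
Proof.
move=> fg c; rewrite (chain_sum c) !linear_sum; apply: eq_bigr => s _.
by rewrite !linearZ /= fg.
Qed.

End LinearExtension.

Section Cone.
Variables (F : fieldType) (V : finType).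
Implicit Types (x y : V) (s : {set V}) (c : chain F V) (l : seq V).

Local Notation fc := (face_chain F).
Local Notation bd := (boundary F V).

(** Exterior multiplication by [x] from the left; the sign counts the transpositions that bring [x]
    to its place in the orientation. *)
Definition cone x : 'End(chain F V) :=
  lext (fun s => if x \in s then 0 else (-1) ^+ face_pos s x *: fc (x |: s)).

Lemma cone_face x s : cone x (fc s) =
  if x \in s then 0 else (-1) ^+ face_pos s x *: fc (x |: s).
Proof. exact: lext_face. Qed.

Lemma face_posU1 s x y : x \notin s ->
  face_pos (x |: s) y = ((enum_rank x < enum_rank y) + face_pos s y)%N.
Proof. by move=> xs; rewrite (face_posD1 y (setU11 x s)) setU1K. Qed.

Lemma face_posD1self s x : face_pos (s :\ x) x = face_pos s x.
Proof.
apply: eq_card => y; rewrite !inE; case: eqVneq => //= ->.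
by rewrite ltnn andbF.
Qed.

Lemma rank_lt_anti x y : x != y ->
  (enum_rank x < enum_rank y)%N = ~~ (enum_rank y < enum_rank x)%N.
Proof.
move=> xy; rewrite -leqNgt [RHS]leq_eqVlt orb_idl // => /eqP/val_inj/enum_rank_inj.
by move/eqP; rewrite (negbTE xy).
Qed.

Lemma coneC x y c : cone x (cone y c) = - cone y (cone x c).
Proof.
pose f := (cone x \o cone y)%VF; pose g := (- (cone y \o cone x))%VF.
suff fg : f =1 g by have := fg c; rewrite /f /g opp_lfunE !comp_lfunE.
apply: eq_on_faces => s; rewrite /f /g opp_lfunE !comp_lfunE !cone_face.
have coneZ z a t : cone z (a *: fc t) = a *: cone z (fc t) by rewrite linearZ.
case: ifP => ys; case: ifP => xs;
  rewrite ?linear0 ?oppr0 // !coneZ !cone_face !in_setU1 ?xs ?ys ?orbT ?orbF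
    ?scaler0 ?oppr0 //.
rewrite (eq_sym y x); case: (eqVneq x y) => [_|xy]; first by rewrite !scaler0 oppr0.
rewrite !scalerA -!exprD (face_posU1 _ (negbT ys)) (face_posU1 _ (negbT xs)).
rewrite (rank_lt_anti xy) setUCA -scaleNr; congr (_ *: _).
by case: (_ < _)%N; rewrite /= ?add0n ?add1n ?addnS ?exprS ?mulN1r ?opprK addnC.
Qed.

Lemma cone_cone x c : cone x (cone x c) = 0.
Proof.
pose f := (cone x \o cone x)%VF; pose g := (0 : 'End(chain F V)).
suff fg : f =1 g by have := fg c; rewrite /f /g comp_lfunE zero_lfunE.
apply: eq_on_faces => s; rewrite /f /g comp_lfunE zero_lfunE cone_face.
by case: ifP => xs; rewrite ?linear0 // linearZ /= cone_face setU11 scaler0.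
Qed.

(** On a face containing [x] the cone is zero, and the face is recovered as the one term of its
    boundary to which [x] can be added back. On other faces this is the usual expansion of the
    boundary of a cone. *)
Lemma boundary_cone x c : bd (cone x c) = c - cone x (bd c).
Proof.
pose f := (bd \o cone x)%VF; pose g := \1%VF - (cone x \o bd)%VF.
suff fg : f =1 g.
  by have := fg c; rewrite /f /g add_lfunE opp_lfunE id_lfunE !comp_lfunE.
apply: eq_on_faces => s.
rewrite /f /g add_lfunE opp_lfunE id_lfunE !comp_lfunE cone_face boundary_face.
rewrite /face_boundary linear_sum /=.
under eq_bigr => v _ do rewrite linearZ /= cone_face in_setD1.
case: ifP => xs.
  rewrite linear0 (bigD1 x) //= eqxx /= face_posD1self scalerA -expr2 sqrr_sign.
  rewrite scale1r setD1K // opprD addrA subrr add0r big1 ?oppr0 // => v /andP[_ vx].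
  by rewrite eq_sym vx scaler0.
rewrite linearZ /= boundary_face /face_boundary big_setU1 ?xs //=.
rewrite setU1K ?xs // face_posU1 ?xs // ltnn add0n scalerDr scalerA -expr2.
rewrite sqrr_sign scale1r; congr (_ + _); rewrite scaler_sumr -sumrN.
apply: eq_bigr => v vs; rewrite andbF.
have vx : v != x by apply: contraTneq vs => ->; rewrite xs.
rewrite !scalerA -!exprD (face_posU1 _ (negbT xs)) (face_posD1 x vs).
rewrite (rank_lt_anti vx) -scaleNr; congr (_ *: fc _); last first.
  by rewrite setDUl; congr (_ :|: _); apply/setDidPl; rewrite disjoints1 inE eq_sym.
by case: (_ < _)%N; rewrite /= ?add0n ?add1n ?addnS ?addSn ?exprS ?mulN1r ?opprK // addnC.
Qed.

(** The oriented simplex on a list of vertices, as an iterated exterior product: alternating in the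
    list and zero on lists with repetitions. *)
Definition osimp l : chain F V := foldr (fun x => cone x) (fc set0) l.

Lemma osimp_cons x l : osimp (x :: l) = cone x (osimp l).
Proof. by []. Qed.

Lemma osimp_cat_inj l l1 l2 (a : F) :
  osimp l1 = a *: osimp l2 -> osimp (l ++ l1) = a *: osimp (l ++ l2).
Proof. by move=> e; elim: l => //= x l ->; rewrite linearZ. Qed.

Lemma osimp_swap l1 x y l2 :
  osimp (l1 ++ x :: y :: l2) = - osimp (l1 ++ y :: x :: l2).
Proof.
by rewrite -[RHS]scaleN1r; apply: osimp_cat_inj; rewrite scaleN1r !osimp_cons coneC.
Qed.

Lemma osimp_move l1 x l2 :
  osimp (x :: l1 ++ l2) = (-1) ^+ size l1 *: osimp (l1 ++ x :: l2).
Proof.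
elim: l1 => [|y l1 IH] /=; first by rewrite expr0 scale1r.
rewrite coneC (_ : cone x _ = osimp (x :: l1 ++ l2)) // IH linearZ exprS mulN1r.
by rewrite scaleNr.
Qed.

Lemma osimp_nuniq l : ~~ uniq l -> osimp l = 0.
Proof.
elim: l => //= x l IH; rewrite negb_and negbK => /orP[|/IH->]; last exact: linear0.
case/splitPr=> l1 l2; rewrite (_ : cone x _ = osimp (x :: l1 ++ x :: l2)) //.
rewrite osimp_move -[RHS](scaler0 _ ((-1) ^+ size l1)); congr (_ *: _).
by elim: l1 => [|y l1 IH1] /=; [exact: cone_cone | rewrite IH1 linear0].
Qed.

Lemma set_cons x l : [set y in x :: l] = x |: [set y in l].
Proof. by apply/setP => y; rewrite !inE. Qed.

Lemma set_nil : [set y in ([::] : seq V)] = set0.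
Proof. by apply/setP => y; rewrite !inE. Qed.

Lemma osimp_face l : uniq l ->
  exists k, osimp l = (-1) ^+ k *: fc [set x in l].
Proof.
elim: l => [_|x l IH /= /andP[xl /IH[k ->]]].
  by exists 0%N; rewrite expr0 scale1r set_nil.
rewrite linearZ /= cone_face inE (negbTE xl) scalerA -exprD.
by exists (k + face_pos [set y in l] x)%N; rewrite set_cons.
Qed.

Lemma enum_rank_index x : enum_rank x = index x (enum V) :> nat.
Proof.
by rewrite -{2}(nth_enum_rank x x) index_uniq ?enum_uniq // -cardE ltn_ord.
Qed.

Lemma face_pos_enum s x e1 e2 : enum V = e1 ++ x :: e2 ->
  face_pos s x = size [seq y <- e1 | y \in s].
Proof.
move=> He; have := enum_uniq V; rewrite He cat_uniq => /and3P[ue1 xe _].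
have ux : x \notin e1 by apply: contra xe => xe1; rewrite /= xe1.
rewrite -(card_uniqP (filter_uniq _ ue1)); apply: eq_card => y; rewrite !inE.
rewrite !enum_rank_index He !index_cat (negbTE ux) /= eqxx addn0 mem_filter.
case: (boolP (y \in e1)) => ye1; first by rewrite index_mem ye1.
by rewrite ltnNge leq_addr.
Qed.

(** Induction over the suffixes of [enum V]: the vertex added in front precedes all others of the
    suffix, so its cone carries the sign 1. *)
Lemma osimp_enum s : osimp (enum s) = fc s.
Proof.
suff H e2 : forall e1, enum V = e1 ++ e2 ->
    osimp [seq x <- e2 | x \in s] = fc (s :&: [set x in e2]).
  rewrite /enum_mem -enumT (H _ [::]) // (_ : _ :&: _ = s) //.
  by apply/setP => x; rewrite !inE mem_enum andbT.
elim: e2 => [|x e2 IH] e1 He; first by rewrite set_nil setI0.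
have He' : enum V = rcons e1 x ++ e2 by rewrite cat_rcons.
have := enum_uniq V; rewrite He cat_uniq /= => /and3P[_ /norP[xe1 he] /andP[xe2 _]].
rewrite set_cons setIUr; case: ifP => xs /=; rewrite (IH _ He').
  rewrite cone_face !inE (negbTE xe2) andbF (face_pos_enum _ He).
  rewrite (_ : [seq y <- e1 | _] = [::]).
    by rewrite expr0 scale1r (setIidPr (_ : [set x] \subset s)) ?sub1set.
  apply/eqP; rewrite -[_ == _]negbK -has_filter; apply/hasPn => y ye1 /=.
  rewrite !inE negb_and; apply/orP; right; apply: contra he => ye2.
  by apply/hasP; exists y.
rewrite (_ : s :&: [set x] = set0) ?set0U //.
by apply/setP => y; rewrite !inE; case: eqVneq => [->|]; rewrite ?xs ?andbF.
Qed.

End Cone.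

Section PushForward.
Variable F : fieldType.

Section Defs.
Variables (V W : finType) (f : V -> W).

(* For a map that is not injective on a face this is the usual convention:
   the face is sent to zero. *)
Definition push : 'Hom(chain F V, chain F W) :=
  lext (fun s => osimp F [seq f x | x <- enum s]).

(** Moving [f x] from the front to the place of [x] in the enumeration costs one sign for each
    vertex of [s] before [x], which is the sign used by [cone]. *)
Lemma push_cone x c : push (cone F x c) = cone F (f x) (push c).
Proof.
pose g := (push \o cone F x)%VF; pose h := (cone F (f x) \o push)%VF.
suff gh : g =1 h by have := gh c; rewrite /g /h !comp_lfunE.
apply: eq_on_faces => s; rewrite /g /h !comp_lfunE cone_face lext_face -osimp_cons.
case: ifP => [xs|/negbT xs].
  rewrite linear0 osimp_nuniq //= negb_and negbK map_f // mem_enum //.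
rewrite linearZ /= lext_face.
have: x \in enum V by rewrite mem_enum.
case/path.splitPr Ee: {1}(enum V) / => [e1 e2].
have := enum_uniq V; rewrite Ee cat_uniq /= => /and3P[_ /norP[xe1 _] /andP[xe2 _]].
have E (t : {set V}) : enum t = [seq y <- e1 | y \in t] ++
    (if x \in t then [:: x] else [::]) ++ [seq y <- e2 | y \in t].
  by rewrite /enum_mem -enumT Ee filter_cat /=; case: ifP.
rewrite (face_pos_enum s Ee) (E s) (E (x |: s)) setU11 (negbTE xs) /=.
have e_eq e : x \notin e ->
    [seq y <- e | y \in x |: s] = [seq y <- e | y \in s].
  move=> xe; apply: eq_in_filter => y ye; rewrite !inE.
  by case: eqVneq ye xe => // -> ->.
by rewrite !e_eq // !map_cat -osimp_cons osimp_move size_map.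
Qed.

Lemma push_osimp l : push (osimp F l) = osimp F (map f l).
Proof.
elim: l => [|x l IH]; last by rewrite osimp_cons push_cone IH.
by rewrite /= lext_face enum_set0.
Qed.

Lemma push_boundary c : boundary F W (push c) = push (boundary F V c).
Proof.
pose g := (boundary F W \o push)%VF; pose h := (push \o boundary F V)%VF.
suff gh : g =1 h by have := gh c; rewrite /g /h !comp_lfunE.
apply: eq_on_faces => s; rewrite /g /h !comp_lfunE -osimp_enum.
elim: (enum s) => [|x l IH].
  by rewrite push_osimp /= !boundary_face /face_boundary !big_set0 linear0.
by rewrite osimp_cons push_cone !boundary_cone IH linearB /= push_cone.
Qed.

End Defs.
End PushForward.

(** * Boundary ranks under deletion of a vertex *)

Section Ranks.
Variables (F : fieldType) (V : finType).
Implicit Types (x : V) (s : {set V}) (K : {set {set V}}) (m : nat).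

Local Notation fc := (face_chain F).
Local Notation bd := (boundary F V).

Definition faces K m := [set s in K | #|s| == m].

(** Indexed by the number [m] of elements of a face, so that the empty face has index 0 and no
    negative degree occurs. *)
Definition schains K m : {vspace chain F V} := <<[seq fc s | s in faces K m]>>%VS.

Definition rank K m := \dim (bd @: schains K m).

Lemma schains_img (W : vectType F) (f : 'Hom(chain F V, W)) K m (U : {vspace W}) :
  reflect (forall s, s \in K -> #|s| = m -> f (fc s) \in U) (f @: schains K m <= U)%VS.
Proof.
rewrite limg_span; apply: (iffP span_subvP) => H.
  move=> s sK sm; apply/H/map_f/map_f; by rewrite mem_enum inE sK sm eqxx.
move=> c /mapP[_ /mapP[s sK ->] ->]; move: sK; rewrite mem_enum inE.
by case/andP=> sK /eqP; apply: H.
Qed.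

Definition coef s : 'Hom(chain F V, F^o) := lext (fun t => (t == s)%:R : F^o).

Lemma coef_face s t : coef s (fc t) = ((t == s)%:R : F).
Proof. exact: lext_face. Qed.

Lemma dim_schains K m : \dim (schains K m) = #|faces K m|.
Proof.
have := size_map (fun s => fc s) (enum (faces K m)); rewrite -cardE => <-; apply/eqP.
apply: (free_triangular (phi := coef)) => [s _|]; first by rewrite coef_face eqxx oner_eq0.
elim: (enum _) (enum_uniq (faces K m)) => //= s r IH /andP[sr /IH->].
rewrite andbT; apply/allP => t tr; rewrite coef_face.
by rewrite (_ : t == s = false) //; apply: contraNF sr => /eqP <-.
Qed.

Lemma rank0 K : rank K 0 = 0%N.
Proof.
apply/eqP; rewrite dimv_eq0 -subv0; apply/schains_img => s _ /eqP.
rewrite cards_eq0 => /eqP->.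
by rewrite boundary_face /face_boundary big_set0 mem0v.
Qed.

Lemma boundary_schains K m : simplicial_complex K ->
  (bd @: schains K m.+1 <= schains K m)%VS.
Proof.
move=> Kcl; apply/schains_img => s sK sm; rewrite boundary_face.
apply: memv_suml => v vs; apply/memvZ/memv_span/map_f; rewrite mem_enum inE.
by rewrite (Kcl _ _ sK) ?subsetDl //=; move: sm; rewrite (cardsD1 v) vs => -[<-].
Qed.

(** Boundaries are cycles, and the cycles of size [m] have the dimension given by rank-nullity. *)
Lemma rank_le_faces K m : simplicial_complex K ->
  (rank K m + rank K m.+1 <= #|faces K m|)%N.
Proof.
move=> Kcl; rewrite -dim_schains -(limg_ker_dim bd (schains K m)) addnC leq_add2r.
apply: dimvS; rewrite subv_cap boundary_schains //; apply/schains_img => s _ _.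
by rewrite memv_ker boundary_face boundary_boundary_face.
Qed.

Lemma reduced_bettiE K d :
  reduced_betti F K d = (#|faces K d.+1| - rank K d.+1 - rank K d.+2)%N.
Proof.
rewrite /reduced_betti -dim_schains -(limg_ker_dim bd (schains K d.+1)).
by rewrite [X in (X - _ - _)%N]addnC addKn.
Qed.

Section DeleteVertex.
Variables (K : {set {set V}}) (e : V).

Definition del := [set s in K | e \notin s].
Definition link := [set s : {set V} | (e \notin s) && (e |: s \in K)].

Let p : 'End(chain F V) := lext (fun s => if e \in s then fc s else 0).

Let p_face s : p (fc s) = if e \in s then fc s else 0.
Proof. exact: lext_face. Qed.

Let p_cone c : p (cone F e c) = cone F e c.
Proof.
suff E : (p \o cone F e)%VF =1 cone F e by rewrite -[RHS]E comp_lfunE.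
apply: eq_on_faces => s; rewrite comp_lfunE cone_face.
by case: ifP => es; rewrite ?linear0 // linearZ /= p_face setU11.
Qed.

Let p_boundary s : e \notin s -> p (bd (fc s)) = 0.
Proof.
move=> es; rewrite boundary_face /face_boundary linear_sum big1 // => v _.
by rewrite linearZ /= p_face inE (negbTE es) andbF scaler0.
Qed.

Let cone_faceE s : e \notin s ->
  cone F e (fc s) = (-1) ^+ face_pos s e *: fc (e |: s).
Proof. by rewrite cone_face => /negbTE->. Qed.

Let mem_cone (W : vectType F) (f : 'Hom(chain F V, W)) U m s :
    (f @: schains K m.+1 <= U)%VS -> s \in link -> #|s| = m ->
  f (cone F e (fc s)) \in U.
Proof.
move/schains_img => fU; rewrite inE => /andP[es esK] sm.
by rewrite cone_faceE // linearZ memvZ // fU // cardsU1 es sm.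
Qed.

(** Rank-nullity for the projection [p] onto the faces through [e], restricted to the boundaries of
    [K]. The kernel contains the boundaries of [del]. The image contains the cones over the
    boundaries of [link], because [p] maps the boundary of the cone over [s] to minus the cone over
    the boundary of [s]. *)
Lemma rank_delete m : (rank del m.+1 + rank link m <= rank K m.+1)%N.
Proof.
rewrite [X in (_ <= X)%N]/rank -(limg_ker_dim p) leq_add //.
  apply/dimvS; apply/schains_img => s; rewrite inE => /andP[sK es] sm.
  rewrite memv_cap memv_ker p_boundary // eqxx andbT.
  have /schains_img := subvv (bd @: schains K m.+1)%VS; exact.
(* If the cone over [c] is zero, then [c] is the cone over its own boundary, so all its faces
   contain [e]; but [c] avoids [e]. *)
have inj : (bd @: schains link m :&: lker (cone F e) = 0)%VS.
  apply/eqP; rewrite -subv0; apply/subvP => c; rewrite memv_cap memv0.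
  case/andP=> cL; rewrite memv_ker => /eqP c0.
  have pc : p c = 0.
    apply/eqP; rewrite -memv_ker; move: c cL {c0}; apply/subvP.
    apply/schains_img => s; rewrite inE => /andP[es _] _.
    by rewrite memv_ker p_boundary.
  have := boundary_cone e c; rewrite c0 linear0 => /eqP; rewrite eq_sym subr_eq0.
  by move=> /eqP Ec; rewrite Ec -p_cone -Ec pc.
rewrite /rank -(limg_dim_eq inj); apply/dimvS.
rewrite -limg_comp; apply/schains_img => s sL sm.
have es : e \notin s by move: sL; rewrite inE => /andP[].
rewrite comp_lfunE.
have := mem_cone (subvv (bd @: schains K m.+1)%VS) sL sm.
move/(memv_img p); rewrite boundary_cone linearB /= p_cone p_face (negbTE es) sub0r.
by rewrite memvN.
Qed.

(** The complementary projection [1 - p] maps the boundary of the cone over a face [s] of the link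
    to [s] itself, so it sends the boundaries onto a space containing all chains of the link. *)
Lemma rank_cone m : (#|faces link m| <= rank K m.+1)%N.
Proof.
have := limg_ker_dim (\1%VF - p) (bd @: schains K m.+1).
rewrite -dim_schains /rank => <-; apply: leq_trans (leq_addl _ _).
apply/dimvS; rewrite -[X in (X <= _)%VS]lim1g; apply/schains_img => s sL sm.
have es : e \notin s by move: sL; rewrite inE => /andP[].
have := mem_cone (subvv (bd @: schains K m.+1)%VS) sL sm.
move/(memv_img (\1%VF - p)); rewrite add_lfunE opp_lfunE !id_lfunE boundary_cone.
by rewrite linearB /= p_cone p_face (negbTE es) sub0r opprK addrNK.
Qed.

End DeleteVertex.
End Ranks.

Lemma card_faces_delete (V : finType) (K : {set {set V}}) e m :
  #|faces K m.+1| = (#|faces (del K e) m.+1| + #|faces (link K e) m|)%N.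
Proof.
have inj : {in faces (link K e) m &, injective (fun s => e |: s)}.
  move=> s t; rewrite !inE => /andP[/andP[es _] _] /andP[/andP[et _] _] st.
  by rewrite -(setU1K es) st setU1K.
rewrite -(card_in_imset inj) -(cardsID [set s : {set V} | e \notin s] (faces K m.+1)); congr (_ + _)%N.
  by apply: eq_card => s; rewrite !inE andbAC.
apply: eq_card => s; rewrite !inE negbK; apply/andP/imsetP => [[es /andP[sK sm]]|].
  exists (s :\ e); last by rewrite setD1K.
  rewrite !inE eqxx setD1K // sK /=; move: sm; rewrite (cardsD1 e) es; lia.
case=> t; rewrite !inE => /andP[/andP[et tK] /eqP tm] ->.
by rewrite setU11 tK cardsU1 et tm eqxx.
Qed.

(** * Deletion of edges *)

Section MatchingComplexes.
Variables (F : fieldType) (V : finType).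
Implicit Types (E A : {set {set V}}) (e f : {set V}) (S T : {set V}) (q m c : nat).

Definition matchings E : {set {set {set V}}} :=
  [set M : {set {set V}} | (M \subset E) && trivIset M].

(* The Betti number in homological degree [q - 2]; the shift makes the
   deletion inequality hold without exception, and costs nothing since
   nothing lives below the empty face. *)
Definition betti E q : nat :=
  if q is m.+1 then
    (#|faces (matchings E) m| -
       (rank F (matchings E) m + rank F (matchings E) m.+1))%N
  else 0%N.

Arguments betti E q : simpl never.

Definition away E e := [set f in E | [disjoint f & e]].

Lemma in_away E e f : (f \in away E e) = (f \in E) && [disjoint f & e].
Proof. by rewrite inE. Qed.

Lemma matchings_closed E : simplicial_complex (matchings E).
Proof.
move=> M N; rewrite !inE => /andP[ME Mt] NM.
by rewrite (subset_trans NM ME) (trivIsetS NM Mt).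
Qed.

Lemma del_matchings E e : del (matchings E) e = matchings (E :\ e).
Proof. by apply/setP => M; rewrite !inE subsetD1 andbAC. Qed.

(** Excluding [set0] ensures that [e] meets itself, hence that [e] does not belong to [away E e]. *)
Lemma link_matchings E e : set0 \notin E -> e \in E ->
  link (matchings E) e = matchings (away E e).
Proof.
move=> E0 eE; apply/setP => M; rewrite !inE subUset sub1set eE /=.
have e0 : ~~ [disjoint e & e] by rewrite -setI_eq0 setIid; apply: contraNneq E0 => <-.
apply/and3P/andP => [[eM ME /trivIsetP Mt]|[/subsetP MA /trivIsetP Mt]].
  split; last first.
    by apply/trivIsetP => f g fM gM; apply: Mt; rewrite in_setU1 ?fM ?gM orbT.
  apply/subsetP => f fM; rewrite inE (subsetP ME) //= Mt ?setU11 ?setU1r //.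
  by apply: contraNneq eM => <-.
split.
- by apply: contra e0 => /MA; rewrite inE => /andP[].
- by apply/subsetP => f /MA; rewrite inE => /andP[].
apply/trivIsetP => f g; rewrite !in_setU1.
have dM h : h \in M -> [disjoint h & e] by move/MA; rewrite inE => /andP[].
case/predU1P=> [->|fM] /predU1P[->|gM] fg; rewrite ?(eqxx, dM) //.
- by rewrite eqxx in fg.
- by rewrite disjoint_sym dM.
exact: Mt.
Qed.

Lemma betti_away_le E e m : set0 \notin E -> e \in E ->
  (#|faces (matchings (away E e)) m| <= rank F (matchings E) m.+1)%N.
Proof. by move=> E0 eE; rewrite -link_matchings // rank_cone. Qed.

Lemma betti1 E e : set0 \notin E -> e \in E -> betti E 1 = 0%N.
Proof.
move=> E0 eE; apply/eqP; rewrite subn_eq0 rank0 add0n.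
apply: leq_trans (betti_away_le 0 E0 eE); apply/subset_leq_card/subsetP => M.
rewrite !inE => /andP[_]; rewrite cards_eq0 => /eqP->; rewrite sub0set eqxx.
by rewrite andbT; apply/trivIsetP => f g; rewrite inE.
Qed.

(** Face counts are additive under deletion and link, while both boundary ranks are superadditive by
    [rank_delete]. *)
Lemma betti_delete E e q : set0 \notin E -> e \in E ->
  (betti E q.+1 <= betti (E :\ e) q.+1 + betti (away E e) q)%N.
Proof.
move=> E0 eE; case: q => [|m]; first by rewrite (betti1 E0 eE).
have := card_faces_delete (matchings E) e m.
have := rank_delete F (matchings E) e m; have := rank_delete F (matchings E) e m.+1.
by rewrite /betti del_matchings link_matchings //; lia.
Qed.

(** The faces with and without [e] are both counted by matchings of [away E e], and [betti_away_le]
    bounds the two boundary ranks below by these counts. *)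
Lemma betti_cone E e q : set0 \notin E -> e \in E -> away E e = E :\ e ->
  betti E q = 0%N.
Proof.
move=> E0 eE Ee; case: q => [|[|m]] //; first exact: betti1 E0 eE.
have := card_faces_delete (matchings E) e m.
have := betti_away_le m E0 eE; have := betti_away_le m.+1 E0 eE.
by rewrite /betti del_matchings link_matchings // Ee; lia.
Qed.

(** The edges of [A] are deleted one at a time. Since they meet pairwise, the edges disjoint from a
    given [e] in [A] are the same whichever members of [A] are already gone. *)
Lemma betti_delete_star E A q c : set0 \notin E -> A \subset E ->
    {in A &, forall e f, ~~ [disjoint f & e]} ->
    {in A, forall e, betti (away (E :\: A) e) q <= c}%N ->
  (betti E q.+1 <= betti (E :\: A) q.+1 + #|A| * c)%N.
Proof.
have [n] := ubnP #|A|; elim: n A E => // n IH A E An E0 AE Astar Ac.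
have [->|[e eA]] := set_0Vmem A; first by rewrite setD0 cards0 mul0n addn0.
have eE := subsetP AE e eA.
have E'A : (E :\ e) :\: (A :\ e) = E :\: A.
  by rewrite setDDl setD1K.
have e_away : away E e = away (E :\: A) e.
  apply/setP => f; rewrite !inE; case: (boolP (f \in A)) => //= fA.
  by rewrite (negbTE (Astar _ _ eA fA)) andbF.
apply: leq_trans (betti_delete q E0 eE) _; rewrite e_away.
have: (#|A :\ e| < n)%N by move: An; rewrite (cardsD1 e) eA.
move/(IH _ (E :\ e)); rewrite E'A (cardsD1 e A) eA => H.
have {}H: (betti (E :\ e) q.+1 <= betti (E :\: A) q.+1 + #|A :\ e| * c)%N.
  apply: H.
  - by rewrite inE negb_and E0 orbT.
  - exact: setSD.
  - by move=> f g /setD1P[_ fA] /setD1P[_ gA]; apply: Astar.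
  - by move=> f /setD1P[_ fA]; apply: Ac.
by rewrite /= add1n mulSn addnCA addnC leq_add // Ac.
Qed.

(** * Recursion for complete graphs with or without an edge *)

Definition clique S : {set {set V}} := [set e : {set V} | (e \subset S) && (#|e| == 2)].

Lemma pairE f x y : #|f| = 2 -> x != y -> x \in f -> y \in f -> f = [set x; y].
Proof.
move=> f2 xy xf yf; apply/esym/eqP; rewrite eqEcard subUset !sub1set xf yf.
by rewrite cards2 xy f2.
Qed.

Lemma card_star A T x : (forall f, f \in A -> [&& #|f| == 2, x \in f & f :\ x \subset T]) ->
  (#|A| <= #|T|)%N.
Proof.
move=> AT; apply: leq_trans (leq_imset_card (fun y => [set x; y]) T).
apply/subset_leq_card/subsetP => f /AT/and3P[/eqP f2 xf fT].
have /cards1P[y fy] : #|f :\ x| == 1%N by move: f2; rewrite (cardsD1 x) xf; lia.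
have yT : y \in T by rewrite -sub1set -fy.
apply/imsetP; exists y => //; have : y \in f :\ x by rewrite fy set11.
by case/setD1P => yx yf; apply: pairE; rewrite // eq_sym.
Qed.

Lemma notin0 E : {in E, forall e, #|e| = 2} -> set0 \notin E.
Proof. by move=> E2; apply/negP => /E2; rewrite cards0. Qed.

Section Recursion.
Variables (S : {set V}) (a b w : V).
Hypotheses (aS : a \in S) (bS : b \in S) (wS : w \in S).
Hypotheses (ab : a != b) (aw : a != w) (bw : b != w).

Let wa : w != a. Proof. by rewrite eq_sym. Qed.
Let ba : b != a. Proof. by rewrite eq_sym. Qed.
Let wb : w != b. Proof. by rewrite eq_sym. Qed.

Lemma betti_clique q :
  (betti (clique S) q.+1 <=
     betti (clique S :\ [set a; b]) q.+1 + betti (clique (S :\ a :\ b)) q)%N.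
Proof.
have -> : clique (S :\ a :\ b) = away (clique S) [set a; b].
  apply/setP => f; rewrite !inE !subsetD1.
  rewrite disjoint_sym disjoints_subset subUset !sub1set !inE.
  by case: (_ \subset S); case: (_ \in _); case: (_ \in _); rewrite /= ?andbF ?andbT.
apply: betti_delete; last by rewrite !inE subUset !sub1set aS bS cards2 ab.
by apply: notin0 => e; rewrite inE => /andP[_ /eqP].
Qed.

Lemma meet_not_disjoint (A B : {set V}) x : x \in A -> x \in B -> ~~ [disjoint A & B].
Proof. by move=> xA xB; apply/pred0Pn; exists x; rewrite /= xA. Qed.

(** The complete graph on [U] without [a], in which [w] has been made pendant: its only edge is
    [bw]. *)
Let G (U : {set V}) := [set f : {set V} |
  [&& f \subset U, #|f| == 2, (w \in f) ==> (b \in f) & a \notin f]].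

(** Deleting the other edges at [b], at most [#|U| - 2] of them, leaves [bw] disjoint from all the
    rest, hence a cone. In the link of a deleted edge [e] no edge meets [w], so it is complete on
    [U] without [e] and [w]. *)
Lemma betti_pendant (U : {set V}) q c : a \notin U -> b \in U -> w \in U ->
    (forall T, T \subset U -> #|U| = (#|T| + 3)%N -> betti (clique T) q.-1 <= c)%N ->
  (betti (G U) q <= (#|U| - 2) * c)%N.
Proof.
move=> aU bU wU; case: q => [//|q] Hc.
pose A := [set f in G U | (b \in f) && (w \notin f)].
have GU2 : {in G U, forall f, #|f| = 2} by move=> f; rewrite inE => /and4P[_ /eqP].
have AE : A \subset G U by apply/subsetP => f; rewrite inE => /andP[].
have GA0 : set0 \notin G U :\: A by apply: notin0 => f /setDP[/GU2].
have bwE : [set b; w] \in G U :\: A.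
  rewrite !inE subUset !sub1set bU wU cards2 bw !eqxx !orbT !andbF /=.
  by rewrite (negbTE ab) (negbTE aw).
have -> : ((#|U| - 2) * c = betti (G U :\: A) q.+1 + (#|U| - 2) * c)%N.
  rewrite (betti_cone _ GA0 bwE) //; apply/setP => f.
  rewrite in_away in_setD1; apply/andP/andP => [[/setDP[fG fA] fbw]|[fbw /setDP[fG fA]]].
    split; last by rewrite in_setD fG fA.
    apply: contraTneq fbw => ->; exact: (meet_not_disjoint (set21 _ _) (set21 _ _)).
  split; first by rewrite in_setD fG fA.
  have f2 := GU2 f fG; move: fG fA; rewrite !inE => /and4P[-> -> /implyP wfb ->] /=.
  rewrite implybE disjoint_sym disjoints_subset subUset !sub1set !inE.
  case bf: (b \in f); case wf: (w \in f) => //=; last by rewrite wfb in bf.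
  by case/eqP: fbw; apply: pairE.
apply: leq_trans (@betti_delete_star _ A q c _ AE _ _) _; last first.
- rewrite leq_add2l leq_mul2r; apply/orP; right.
  have -> : (#|U| - 2 = #|U :\ b :\ w|)%N.
    by rewrite (cardsD1 b U) (cardsD1 w (U :\ b)) bU in_setD1 wU wb !add1n !subSS subn0.
  apply: (@card_star _ _ b) => f; rewrite !inE => /andP[/and4P[fU -> _ _] /andP[-> wf]] /=.
  by rewrite subsetD1 inE (negbTE wf) andbF andbT setSD.
- move=> e; rewrite inE => /andP[eG /andP[be we]].
  have e2 := GU2 e eG; move: eG; rewrite inE => /and4P[eU _ _ ae].
  have -> : away (G U :\: A) e = clique ((U :\: e) :\ w).
    apply/setP => f; rewrite in_away in_setD [RHS]inE subsetD1 subsetD.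
    case: (boolP [disjoint f & e]) => fe; rewrite ?andbT ?andbF //.
    have bf : b \notin f by rewrite (disjointFl fe be).
    case fU: (f \subset U); rewrite !inE fU ?andbF //= (negbTE bf) andbF /=.
    have -> : a \notin f by apply: contra aU; apply/subsetP.
    by rewrite implybF andbT andbC.
  apply: Hc; first by apply: subset_trans (subsetDl _ _) (subsetDl _ _).
  have := cardsID e U; rewrite (setIidPr eU) e2 => <-.
  by rewrite (cardsD1 w (U :\: e)) in_setD we wU addnC !add1n addn2 addn3.
- move=> e f; rewrite !inE => /andP[_ /andP[be _]] /andP[_ /andP[bf _]].
  exact: (meet_not_disjoint bf be).
exact: notin0.
Qed.

Let cardsD2 e : e \subset S -> #|e| = 2 -> #|S| = (#|S :\: e| + 2)%N.
Proof. by move=> eS e2; rewrite -(cardsID e S) (setIidPr eS) e2 addnC. Qed.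

(** With n = [#|S|], the stars [A1], [A2], [A3] at [w], [a], [b] are deleted in turn. The links are
    complete graphs minus [ab] on n - 2 points for [A1], pendant graphs on n - 2 points for [A2],
    and cones for [A3]. What remains, [E4], consists of [aw], [bw] and the edges avoiding [a], [b]
    and [w]. *)
Lemma betti_clique_minus q c2 c3 c5 :
    (forall T, T \subset S -> a \in T -> b \in T -> #|S| = (#|T| + 2)%N ->
       betti (clique T :\ [set a; b]) q <= c2)%N ->
    (forall T, T \subset S -> #|S| = (#|T| + 3)%N -> betti (clique T) q <= c3)%N ->
    (forall T, T \subset S -> #|S| = (#|T| + 5)%N -> betti (clique T) q.-1 <= c5)%N ->
  (betti (clique S :\ [set a; b]) q.+1 <=
     (#|S| - 3) * c2 + (#|S| - 3) * ((#|S| - 4) * c5) + c3)%N.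
Proof.
move=> H2 H3 H5.
pose E1 := clique S :\ [set a; b].
pose A1 := [set f in E1 | [&& w \in f, a \notin f & b \notin f]].
pose A2 := [set f in E1 :\: A1 | (a \in f) && (w \notin f)].
pose A3 := [set f in E1 :\: A1 :\: A2 | (b \in f) && (w \notin f)].
pose E4 := E1 :\: A1 :\: A2 :\: A3.
have E1_2 f : f \in E1 -> #|f| = 2 by rewrite !inE => /and3P[_ _ /eqP].
have E1S f : f \in E1 -> f \subset S by rewrite !inE => /and3P[].
have E2_1 f : f \in E1 :\: A1 -> f \in E1 by case/setDP.
have E3_1 f : f \in E1 :\: A1 :\: A2 -> f \in E1 by case/setDP => /E2_1.
have E4_1 f : f \in E4 -> f \in E1 by case/setDP => /E3_1.
have sub3 (U : {set V}) x y z : x \in U -> y \in U -> z \in U -> x != y -> x != z -> y != z ->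
    (#|U| = #|U :\ x :\ y :\ z| + 3)%N.
  move=> xU yU zU xy xz yz.
  rewrite (cardsD1 x U) (cardsD1 y (U :\ x)) (cardsD1 z (U :\ x :\ y)) !in_setD1.
  by rewrite xU yU zU ![_ == x]eq_sym xy xz eq_sym yz !add1n addn3.
have S'E : (#|S| - 3 = #|S :\ a :\ b :\ w|)%N by rewrite (sub3 S a b w) // addnK.
have star q' x (A E : {set {set V}}) c : {in A, forall f, x \in f} -> A \subset E ->
    {in E, forall f, #|f| = 2} ->
    {in A, forall e, betti (away (E :\: A) e) q' <= c}%N ->
    (betti E q'.+1 <= betti (E :\: A) q'.+1 + #|A| * c)%N.
  move=> Ax AE E2 H; apply: betti_delete_star => // [|e f /Ax xe /Ax xf].
    exact: notin0.
  exact: meet_not_disjoint xf xe.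
have A1E : A1 \subset E1 by apply/subsetP => f; rewrite inE => /andP[].
have A2E : A2 \subset E1 :\: A1 by apply/subsetP => f; rewrite inE => /andP[].
have A3E : A3 \subset E1 :\: A1 :\: A2 by apply/subsetP => f; rewrite inE => /andP[].
have step1 : (betti E1 q.+1 <= betti (E1 :\: A1) q.+1 + #|A1| * c2)%N.
  apply: (star q w) => // [f|e]; first by rewrite inE => /and4P[].
  rewrite inE => /andP[eE /and3P[we ae be]]; have e2 := E1_2 e eE; have eS := E1S e eE.
  have -> : away (E1 :\: A1) e = clique (S :\: e) :\ [set a; b].
    apply/setP => f; rewrite in_away !inE subsetD.
    case: (boolP [disjoint f & e]) => fe; rewrite ?andbT ?andbF //=.
    by rewrite (disjointFl fe we) andbF.
  apply: H2; rewrite ?subsetDl ?inE ?ae ?be ?aS ?bS //; exact: cardsD2.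
have step2 : (betti (E1 :\: A1) q.+1 <=
    betti (E1 :\: A1 :\: A2) q.+1 + #|A2| * ((#|S| - 4) * c5))%N.
  apply: (star q a) => // [f|f /E2_1/E1_2 //|e]; first by rewrite inE => /and3P[].
  rewrite inE => /andP[/E2_1 eE /andP[ae we]].
  have e2 := E1_2 e eE; have eS := E1S e eE.
  have be : b \notin e.
    move: eE; rewrite 2!inE => /andP[eab _]; apply: contra eab => be.
    by rewrite (pairE e2 ab).
  have -> : away (E1 :\: A1 :\: A2) e = G (S :\: e).
    apply/setP => f; rewrite in_away !inE subsetD.
    case: (boolP [disjoint f & e]) => fe; rewrite ?andbT ?andbF //=.
    rewrite (disjointFl fe ae) /= ?andbT ?andbF.
    have -> : f != [set a; b].
      by apply: contraFneq (disjointFl fe ae) => ->; rewrite set21.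
    case: (f \subset S); case: (#|f| == 2); rewrite ?andbF //=.
    by case: (w \in f); case: (b \in f).
  have -> : (#|S| - 4 = #|S :\: e| - 2)%N.
    by rewrite (cardsD2 eS e2) (subnDA 2 _ 2) addnK.
  apply: betti_pendant; rewrite ?inE ?ae ?be ?we ?bS ?wS // => T TS cT.
  apply: H5; first exact: subset_trans TS (subsetDl _ _).
  by rewrite (cardsD2 eS e2) cT -addnA.
have E4_notin0 : set0 \notin E4 by apply: notin0 => f /E4_1/E1_2.
have set2_neq x y z : x != z -> y != z -> (z \in [set x; y]) = false.
  by rewrite !inE ![z == _]eq_sym => /negbTE-> /negbTE->.
have neq_mem x (f g : {set V}) : (x \in f) = false -> x \in g -> f != g.
  by move=> xf xg; apply: contraFneq xf => ->.
have E4E f : f \in E4 = [&& f != [set a; b], f \subset S, #|f| == 2,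
    (w \in f) ==> (a \in f) || (b \in f) & (a \in f) || (b \in f) ==> (w \in f)].
  rewrite !inE; case: (w \in f); case: (a \in f); case: (b \in f);
  by case: (f == _); case: (f \subset S); case: (#|f| == 2).
have awE : [set a; w] \in E4.
  rewrite E4E set21 set22 subUset !sub1set aS wS cards2 aw !andbT /=.
  by rewrite (@neq_mem b) ?set22 // set2_neq.
have bwE : [set b; w] \in E4.
  rewrite E4E set21 set22 orbT subUset !sub1set bS wS cards2 bw !andbT /=.
  by rewrite (@neq_mem a) ?set21 // set2_neq.
have E4_cone f : f \in E4 -> f != [set a; w] -> f != [set b; w] ->
    [&& a \notin f, b \notin f & w \notin f].
  rewrite E4E => /and5P[_ _ /eqP f2 wf fw] faw fbw.
  have wNf : w \notin f.
    apply: contra faw => wf'; case/orP: (implyP wf wf') => [af|bf].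
      by rewrite (pairE f2 aw).
    by case/eqP: fbw; apply: pairE.
  by move: fw; rewrite (negbTE wNf) implybF negb_or andbT.
(* Once [bw] is gone, [aw] is disjoint from every other edge and serves as apex. *)
have cone4 q' (E : {set {set V}}) : {subset E <= E4} ->
    [set a; w] \in E -> [set b; w] \notin E -> betti E q' = 0%N.
  move=> EE4 Eaw Ebw; apply: (betti_cone _ _ Eaw).
    by apply: notin0 => f /EE4/E4_1/E1_2.
  apply/setP => f; rewrite in_away in_setD1 andbC; case fE: (f \in E); last by rewrite !andbF.
  rewrite !andbT; case: (eqVneq f [set a; w]) => [->|faw] /=.
    by apply: negbTE; apply: (meet_not_disjoint (set21 _ _) (set21 _ _)).
  have fbw : f != [set b; w] by apply: contraNneq Ebw => <-.
  have /and3P[af bf wf] := E4_cone f (EE4 f fE) faw fbw.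
  by rewrite disjoint_sym disjoints_subset subUset !sub1set !inE af wf.
have step3 : (betti (E1 :\: A1 :\: A2) q.+1 <= betti E4 q.+1 + #|A3| * 0)%N.
  apply: (star q b) => // [f|f /E3_1/E1_2 //|e]; first by rewrite inE => /and3P[].
  rewrite inE => /andP[eE /andP[be we]].
  have ae : a \notin e.
    move: eE; rewrite in_setD inE => /andP[+ eE2].
    by rewrite eE2 we andbT.
  rewrite leqn0; apply/eqP; apply: cone4 => [f||].
  - by rewrite in_away => /andP[].
  - by rewrite in_away awE disjoints_subset subUset !sub1set !inE ae we.
  - by rewrite in_away negb_and (meet_not_disjoint (set21 b w) be) orbT.
(* Deleting [bw] from [E4] leaves a cone, so only its link counts, the complete graph on the n - 3
   other points. *)
have step4 : (betti E4 q.+1 <= betti (clique (S :\ a :\ b :\ w)) q)%N.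
  apply: leq_trans (betti_delete q E4_notin0 bwE) _; rewrite cone4 ?add0n.
  - rewrite (_ : away E4 _ = clique (S :\ a :\ b :\ w)) //.
    apply/setP => f; rewrite in_away E4E disjoint_sym disjoints_subset subUset.
    rewrite !sub1set !inE !subsetD1.
    case: (eqVneq f [set a; b]) => [->|_] /=; first by rewrite set22 !andbF.
    by case: (f \subset S); case: (#|f| == 2); case: (a \in f);
       case: (b \in f); case: (w \in f).
  - by move=> f /setD1P[].
  - rewrite in_setD1 awE andbT; apply: (@neq_mem b); rewrite ?set21 //.
    exact: set2_neq.
  - by rewrite setD11.
have A1n : (#|A1| <= #|S| - 3)%N.
  rewrite S'E; apply: (@card_star _ _ w) => f.
  rewrite inE => /andP[fE /and3P[wf af bf]]; rewrite E1_2 // wf /=.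
  by rewrite setSD // !subsetD1 E1S // af.
have A2n : (#|A2| <= #|S| - 3)%N.
  rewrite S'E; apply: (@card_star _ _ a) => f.
  rewrite inE => /andP[/E2_1 fE /andP[af wf]]; rewrite E1_2 // af /=.
  rewrite !subsetD1 setD11 !in_setD1 (negbTE wf) andbF !andbT.
  rewrite (subset_trans (subsetDl _ _) (E1S f fE)) /=.
  rewrite ba; move: fE; rewrite !inE => /and3P[fab _ /eqP f2].
  by apply: contra fab => bf; rewrite (pairE f2 ab).
have stepE2 : (betti (E1 :\: A1) q.+1 <= (#|S| - 3) * ((#|S| - 4) * c5) + c3)%N.
  apply: leq_trans step2 _; rewrite addnC leq_add ?leq_mul2r ?A2n ?orbT //.
  apply: leq_trans step3 _; rewrite muln0 addn0.
  apply: leq_trans step4 _; apply: H3; last exact: sub3.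
  by do 2!apply: subset_trans (subsetDl _ _) _; exact: subsetDl.
apply: leq_trans step1 _; rewrite addnC -addnA leq_add //.
by rewrite leq_mul2r A1n orbT.
Qed.

End Recursion.

(** * Vanishing range, the bound 1 and the cubic bound *)

Lemma exists_two S : (2 <= #|S|)%N -> exists a b, [/\ a \in S, b \in S & a != b].
Proof.
case/card_gt1P => a [b [aS bS ab]]; by exists a, b.
Qed.

Lemma exists_third S a b : (3 <= #|S|)%N -> a \in S -> b \in S -> a != b ->
  exists w, [/\ w \in S, a != w & b != w].
Proof.
move=> S3 aS bS ab.
have /card_gt0P[w] : (0 < #|S :\ a :\ b|)%N.
  move: S3; rewrite (cardsD1 a) aS (cardsD1 b (S :\ a)) in_setD1 bS eq_sym ab.
  by rewrite !add1n !ltnS.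
rewrite !in_setD1 => /and3P[wb wa wS].
by exists w; rewrite wS ![_ == w]eq_sym.
Qed.

Lemma card_setD2 S a b : a \in S -> b \in S -> a != b -> #|S| = (#|S :\ a :\ b| + 2)%N.
Proof.
move=> aS bS ab; rewrite (cardsD1 a) aS (cardsD1 b (S :\ a)) in_setD1 bS eq_sym ab.
by rewrite !add1n addn2.
Qed.

(** All terms of the recursion stay in the vanishing range, the one on n - 3 points with no slack.
    The second part asks for three points: on two points, removing the edge leaves only the empty
    face, whose Betti number at [q = 1] is 1. *)
Lemma betti_vanish q :
  (forall S, 3 * q <= #|S| + 1 -> betti (clique S) q = 0)%N /\
  (forall S a b, a \in S -> b \in S -> a != b ->
    (3 * q <= #|S| + 1)%N -> (3 <= #|S|)%N -> betti (clique S :\ [set a; b]) q = 0%N).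
Proof.
elim/ltn_ind: q => -[|q] IH; first by [].
have [IHc IHm] := IH q (ltnSn q).
have IHp S : (3 * q.-1 <= #|S| + 1)%N -> betti (clique S) q.-1 = 0%N.
  by case: q IH {IHc IHm} => [//|q] IH; apply: (IH q _).1; rewrite ltnS ltnW.
have Hm S a b : a \in S -> b \in S -> a != b -> (3 * q.+1 <= #|S| + 1)%N ->
    (3 <= #|S|)%N -> betti (clique S :\ [set a; b]) q.+1 = 0%N.
  move=> aS bS ab Sq S3; have [w [wS aw bw]] := exists_third S3 aS bS ab.
  apply/eqP; rewrite -leqn0.
  have := @betti_clique_minus S a b w aS bS wS ab aw bw q 0 0 0.
  rewrite !muln0 !addn0; apply.
  - move=> T _ aT bT ST; case: (posnP q) => [->//|q0].
    by rewrite IHm //; lia.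
  - by move=> T _ ST; rewrite IHc //; lia.
  - by move=> T _ ST; case: (posnP q) => [->//|q0]; rewrite IHp //; lia.
split=> // S Sq.
have S2 : (2 <= #|S|)%N by lia.
have [a [b [aS bS ab]]] := exists_two S2.
have [S3|] := leqP 3 #|S|.
  apply/eqP; rewrite -leqn0.
  apply: leq_trans (betti_clique aS bS ab q) _; rewrite Hm // IHc //.
  by have := card_setD2 aS bS ab; lia.
rewrite ltnS => S2'; have -> : q = 0%N by lia.
apply: (@betti1 _ [set a; b]); last by rewrite !inE subUset !sub1set aS bS cards2 ab.
by apply: notin0 => e; rewrite inE => /andP[_ /eqP].
Qed.

(** One point below the vanishing range every term vanishes except the complete graph on n - 3
    points with index lowered by one, which is the induction hypothesis. The second part starts at
    [q = 4] because [base] concerns complete graphs only. *)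
Lemma betti_le1 q : (forall S, #|S| = 7 -> betti (clique S) 3 <= 1)%N -> (3 <= q)%N ->
  (forall S, #|S| + 2 = 3 * q -> betti (clique S) q <= 1)%N /\
  (forall S a b, a \in S -> b \in S -> a != b -> (4 <= q)%N ->
    (#|S| + 2 = 3 * q)%N -> (betti (clique S :\ [set a; b]) q <= 1)%N).
Proof.
move=> base; elim: q => // q IH; rewrite leq_eqVlt => /predU1P[<-|q3].
  by split=> // S S7; apply: base; lia.
have [IHc _] := IH q3; have [Vc Vm] := betti_vanish q.
have Hm S a b : a \in S -> b \in S -> a != b -> (#|S| + 2 = 3 * q.+1)%N ->
    (betti (clique S :\ [set a; b]) q.+1 <= 1)%N.
  move=> aS bS ab Sq; have S3 : (3 <= #|S|)%N by lia.
  have [w [wS aw bw]] := exists_third S3 aS bS ab.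
  have := @betti_clique_minus S a b w aS bS wS ab aw bw q 0 1 0.
  rewrite !muln0 !add0n; apply.
  - by move=> T _ aT bT ST; rewrite Vm //; lia.
  - by move=> T _ ST; apply: IHc; lia.
  - by move=> T _ ST; rewrite (betti_vanish q.-1).1 //; lia.
split=> [S Sq|S a b aS bS ab _]; last exact: Hm.
have S2 : (2 <= #|S|)%N by lia.
have [a [b [aS bS ab]]] := exists_two S2.
apply: leq_trans (betti_clique aS bS ab q) _; rewrite Vc ?addn0 ?Hm //.
by have := card_setD2 aS bS ab; lia.
Qed.

(** On 3r + 6 points the coefficients of the recursion add up to (3r + 3) + (3r + 3)(3r + 2) = 9(r +
    1)^2, each with a Betti number at most 1, and [betti_clique] contributes one more. Twice 9(r +
    1)^2 + 1 is the increment of the cubic from r to r + 1. *)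
Lemma betti_cubic_bound r : (forall S, #|S| = 7 -> betti (clique S) 3 <= 1)%N ->
    (forall S, #|S| = 12 -> betti (clique S) 5 <= 56)%N -> (3 <= r)%N ->
  (forall S, #|S| = 3 * r + 3 ->
    2 * betti (clique S) r.+2 + 146 <= 6 * r ^ 3 + 9 * r ^ 2 + 5 * r)%N.
Proof.
move=> base7 base12; elim: r => // r IH; rewrite leq_eqVlt => /predU1P[<-|r3] S Sr.
  (* At [r = 3] both sides are equal to 258 for the value 56. *)
  by have := base12 S Sr; lia.
have S3 : (3 <= #|S|)%N by lia.
have [a [b [aS bS ab]]] := exists_two (ltnW S3).
have [w [wS aw bw]] := exists_third S3 aS bS ab.
have [L1c L1m] := betti_le1 base7 (leqW (leqW r3) : (3 <= r.+2)%N).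
have [L2c _] := betti_le1 base7 (leqW r3 : (3 <= r.+1)%N).
have P0 : (146 <= 6 * r ^ 3 + 9 * r ^ 2 + 5 * r)%N.
  apply: leq_trans (_ : 6 * 3 ^ 3 <= _)%N => //.
  by rewrite -addnA (leq_trans _ (leq_addr _ _)) // leq_mul2l leq_exp2r.
(* The bound for [r], rounded down; [P0] guarantees that the natural subtraction is not
   truncated. *)
pose c3 := ((6 * r ^ 3 + 9 * r ^ 2 + 5 * r - 146) %/ 2)%N.
have c3b : (2 * c3 + 146 <= 6 * r ^ 3 + 9 * r ^ 2 + 5 * r)%N.
  by rewrite [leqLHS]addnC -leq_subRL // mulnC leq_trunc_div.
have c3P T : #|T| = (3 * r + 3)%N -> (betti (clique T) r.+2 <= c3)%N.
  by move/(IH r3) => H; rewrite leq_divRL // mulnC leq_subRL // addnC.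
have mb : (betti (clique S :\ [set a; b]) r.+3 <=
    (#|S| - 3) * 1 + (#|S| - 3) * ((#|S| - 4) * 1) + c3)%N.
  apply: (betti_clique_minus aS bS wS ab aw bw) => [T _ aT bT ST|T _ ST|T _ ST].
  - by apply: (L1m T a b aT bT ab); clear -ST Sr r3; lia.
  - by apply: c3P; lia.
  - by apply: L2c; lia.
have cb := betti_clique aS bS ab r.+2.
have lb : (betti (clique (S :\ a :\ b)) r.+2 <= 1)%N.
  by apply: L1c; have := card_setD2 aS bS ab; lia.
have {mb cb lb} : (betti (clique S) r.+3 <= c3 + 9 * r.+1 ^ 2 + 1)%N.
  apply: leq_trans cb _; rewrite leq_add //; apply: leq_trans mb _.
  rewrite Sr; nia.
move: c3b; set h := betti _ _; move: c3 h {c3P IH} => x y; nia.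
Qed.

End MatchingComplexes.

(** * Matchings as lists of edges *)

Section Counting.
Variable (V : finType).
Implicit Types (E A : {set {set V}}) (S : {set V}).

Lemma faces_matchings0 E : #|faces (matchings E) 0| = 1%N.
Proof.
rewrite (_ : faces _ _ = [set set0]) ?cards1 //; apply/setP => M.
rewrite !inE cards_eq0; case: eqVneq => [->|_]; rewrite ?andbF // sub0set andbT.
by apply/trivIsetP => f g; rewrite inE.
Qed.

Lemma card_faces_star E A m c : set0 \notin E -> A \subset E ->
    {in A &, forall e f : {set V}, ~~ [disjoint f & e]} ->
    {in A, forall e : {set V}, #|faces (matchings (away (E :\: A) e)) m| = c} ->
  #|faces (matchings E) m.+1| =
    (#|faces (matchings (E :\: A)) m.+1| + #|A| * c)%N.
Proof.
have [n] := ubnP #|A|; elim: n A E => // n IH A E An E0 AE Astar Ac.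
have [->|[e eA]] := set_0Vmem A; first by rewrite setD0 cards0 mul0n addn0.
have eE := subsetP AE e eA.
have E'A : (E :\ e) :\: (A :\ e) = E :\: A.
  by rewrite setDDl setD1K.
have e_away : away E e = away (E :\: A) e.
  apply/setP => f; rewrite !inE; case: (boolP (f \in A)) => //= fA.
  by rewrite (negbTE (Astar _ _ eA fA)) andbF.
rewrite (card_faces_delete _ e) del_matchings link_matchings // e_away Ac //.
have: (#|A :\ e| < n)%N by move: An; rewrite (cardsD1 e) eA.
move/(IH _ (E :\ e)) => ->.
- by rewrite E'A (cardsD1 e A) eA mulSn addnA addnAC.
- by rewrite inE negb_and E0 orbT.
- exact: setSD.
- by move=> f g /setD1P[_ fA] /setD1P[_ gA]; apply: Astar.
by move=> f /setD1P[_ fA]; rewrite E'A; apply: Ac.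
Qed.

(** One point is either uncovered or joined to one of the [n'] others. For [n' = 0] the factor [n']
    removes the term with [n'.-1]. *)
Fixpoint num_matchings (n m : nat) {struct n} : nat :=
  if m is m'.+1 then
    if n is n'.+1 then (num_matchings n' m + n' * num_matchings n'.-1 m')%N else 0%N
  else 1%N.

Lemma card_matchings S m : #|faces (matchings (clique S)) m| = num_matchings #|S| m.
Proof.
have [n] := ubnP #|S|; elim: n S m => // n IH S m Sn.
case: m => [|m]; first by rewrite faces_matchings0; case: #|S|.
have clique2 f : f \in clique S -> #|f| = 2 by rewrite inE => /andP[_ /eqP].
have clique0 : set0 \notin clique S by apply: notin0.
have [S0|[v vS]] := set_0Vmem S.
  rewrite S0 cards0; apply: eq_card0 => M; rewrite !inE.
  apply/negP => /andP[/andP[/subsetP MS _]]; case: (set_0Vmem M) => [->|[e eM] _].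
    by rewrite cards0.
  have := MS e eM; rewrite inE subset0 => /andP[/eqP-> ].
  by rewrite cards0.
have SE : #|S| = #|S :\ v|.+1 by rewrite (cardsD1 v) vS.
pose A := [set f in clique S | v \in f].
have AE : A \subset clique S by apply/subsetP => f; rewrite inE => /andP[].
have An : #|A| = #|S :\ v|.
  rewrite -(card_in_imset (f := fun y => [set v; y])).
    apply: eq_card => f; apply/idP/imsetP => [|[y /setD1P[yv yS] ->]].
      rewrite !inE => /andP[/andP[fS f2] vf].
      have /cards1P[y fy] : #|f :\ v| == 1%N by move: f2; rewrite (cardsD1 v) vf; lia.
      have /setD1P[yv yf] : y \in f :\ v by rewrite fy set11.
      exists y; first by apply/setD1P; split; [|apply: (subsetP fS)].
      by apply: pairE; rewrite ?(eqP f2) // eq_sym.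
    by rewrite !inE subUset !sub1set vS yS cards2 [v == y]eq_sym yv !eqxx.
  move=> y z /setD1P[yv _] /setD1P[zv _] yz.
  have : y \in [set v; z] by rewrite -yz set22.
  by rewrite !inE (negbTE yv) => /eqP.
have DE : clique S :\: A = clique (S :\ v).
  apply/setP => f; rewrite !inE subsetD1.
  by case: (f \subset S); case: (_ == 2); case: (v \in f).
rewrite (@card_faces_star _ A _ (num_matchings #|S :\ v|.-1 m)) //.
- by rewrite An DE IH ?SE //; move: Sn; rewrite SE.
- by move=> e f /setIdP[_ ve] /setIdP[_ vf]; apply: meet_not_disjoint vf ve.
move=> e /setIdP[eS ve]; have e2 := clique2 e eS.
have eS' : e \subset S by move: eS; rewrite inE => /andP[].
have -> : away (clique S :\: A) e = clique (S :\: e).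
  apply/setP => f; rewrite in_away !inE subsetD.
  case: (boolP [disjoint f & e]) => fe; rewrite ?andbT ?andbF //=.
  by rewrite (disjointFl fe ve) andbF.
have Sn' : #|S :\: e| = #|S :\ v|.-1.
  by have := cardsID e S; rewrite (setIidPr eS') e2 SE; lia.
by rewrite IH Sn' //; move: Sn; rewrite SE; lia.
Qed.

End Counting.

(** * Ordered matchings and invariance under bijections of the points *)

Section MatchingLists.
Variable F : fieldType.

Section OneGraph.
Variable V : finType.
Implicit Types (S : {set V}) (l : seq {set V}) (m : nat).

Definition mlist S l := uniq l && ([set e in l] \in matchings (clique S)).

Lemma mlistP S l : reflect
  [/\ uniq l, {in l, forall e : {set V}, e \subset S /\ #|e| = 2} &
      {in l &, forall e f : {set V}, e != f -> [disjoint e & f]}] (mlist S l).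
Proof.
rewrite /mlist inE; apply: (iffP and3P) => [[ul /subsetP lS /trivIsetP lt]|[ul lS lt]].
  split=> // [e el|e f el fl]; last by apply: lt; rewrite inE.
  by have := lS e; rewrite !inE => /(_ el)/andP[-> /eqP].
split=> //; first by apply/subsetP => e; rewrite !inE => /lS[-> ->].
by apply/trivIsetP => e f; rewrite !inE; apply: lt.
Qed.

Lemma face_osimp S M m : M \in matchings (clique S) -> #|M| = m ->
  exists l, [/\ mlist S l, size l = m & face_chain F M = osimp F l].
Proof.
move=> MS Mm; exists (enum M); rewrite -cardE osimp_enum /mlist enum_uniq.
by rewrite set_enum MS.
Qed.

Lemma osimp_schains S l : mlist S l ->
  osimp F l \in schains F (matchings (clique S)) (size l).
Proof.
move=> /andP[ul lS]; have [k ->] := osimp_face F ul; apply/memvZ/memv_span/map_f.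
by rewrite mem_enum inE lS cardsE (card_uniqP ul) eqxx.
Qed.

(** All orderings of a matching give the same chain up to sign, so inclusions can be tested on
    arbitrary lists, without the order of [enum]. *)
Lemma schains_mlist (W : vectType F) (f : 'Hom(chain F {set V}, W)) S m
    (U : {vspace W}) :
  reflect (forall l, mlist S l -> size l = m -> f (osimp F l) \in U)
    (f @: schains F (matchings (clique S)) m <= U)%VS.
Proof.
apply: (iffP idP) => [fU l lS lm|H].
  by apply: (subvP fU); apply: memv_img; rewrite -lm osimp_schains.
by apply/schains_img => M MS Mm; have [l [lS lm ->]] := face_osimp MS Mm; apply: H.
Qed.

End OneGraph.

Section Transport.
Variables (V W : finType) (f : V -> W) (g : W -> V) (S : {set V}) (T : {set W}).
Hypotheses (fST : {in S, forall x, f x \in T}) (fK : {in S, cancel f g}).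

Lemma mlist_map l : mlist S l -> mlist T (map (fun e : {set V} => f @: e) l).
Proof.
have f_inj : {in S &, injective f} := can_in_inj fK.
have im_inj : {in [pred e : {set V} | e \subset S] &, injective (fun e : {set V} => f @: e)}.
  move=> e1 e2 e1S e2S e12; apply/setP => x.
  have sub (A B : {set V}) : A \subset S -> B \subset S -> f @: A = f @: B -> x \in A -> x \in B.
    move=> AS BS AB xA; have : f x \in f @: B by rewrite -AB imset_f.
    case/imsetP=> y yB fxy.
    by rewrite (f_inj x y (subsetP AS x xA) (subsetP BS y yB) fxy).
  by apply/idP/idP; apply: sub.
case/mlistP => ul lS lt; apply/mlistP; split.
- by rewrite map_inj_in_uniq // => e1 e2 /lS[e1S _] /lS[e2S _]; apply: im_inj.
- move=> _ /mapP[e /lS[eS e2] ->]; split.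
    by apply/subsetP => _ /imsetP[x xe ->]; apply: fST; apply: (subsetP eS).
  by rewrite card_in_imset // => x y xe ye; apply: f_inj; apply: (subsetP eS).
move=> _ _ /mapP[e1 e1l ->] /mapP[e2 e2l ->] e12.
have [e1S _] := lS e1 e1l; have [e2S _] := lS e2 e2l.
have d12 : [disjoint e1 & e2] by apply: lt => //; apply: contraNneq e12 => ->.
apply/pred0Pn => -[_ /andP[/imsetP[x xe1 ->] /imsetP[y ye2 fxy]]].
have xy := f_inj x y (subsetP e1S x xe1) (subsetP e2S y ye2) fxy.
by have := disjointFr d12 xe1; rewrite xy ye2.
Qed.

End Transport.

(** The chain map induced by [f] sends the boundaries over [S] onto a space containing the
    boundaries over [T], since each matching of [T] is the image of its preimage under [f]. *)
Lemma rank_transport (V W : finType) (f : V -> W) (g : W -> V) (S : {set V})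
    (T : {set W}) m :
    {in S, forall x, f x \in T} -> {in S, cancel f g} ->
    {in T, forall y, g y \in S} -> {in T, cancel g f} ->
  (rank F (matchings (clique T)) m <= rank F (matchings (clique S)) m)%N.
Proof.
move=> fST fK gTS gK; pose phi (e : {set V}) := f @: e.
rewrite /rank -[X in (_ <= X)%N](limg_ker_dim (push F phi)).
apply: leq_trans (leq_addl _ _); apply/dimvS/schains_mlist => l lT lm.
pose l' := map (fun e : {set W} => g @: e) l.
have l'l : map phi l' = l.
  case/mlistP: lT => _ lT _; rewrite -map_comp; apply: map_id_in => e /lT[eT _] /=.
  rewrite /phi -imset_comp; apply/setP => y; apply/imsetP/idP => [[z ze ->]|ye] /=.
    by rewrite gK // (subsetP eT).
  by exists y => //=; rewrite gK // (subsetP eT).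
rewrite -l'l -push_osimp push_boundary; do 2!apply: memv_img.
by rewrite -lm -(size_map (fun e : {set W} => g @: e)) osimp_schains // (mlist_map gTS gK).
Qed.

Lemma bijection_sets (V W : finType) (S : {set V}) (T : {set W}) :
    #|S| = #|T| -> (0 < #|S|)%N ->
  exists (f : V -> W) (g : W -> V),
    [/\ {in S, forall x, f x \in T}, {in S, cancel f g},
        {in T, forall y, g y \in S} & {in T, cancel g f}].
Proof.
move=> ST S0; have [v0 v0S] := card_gt0P S0.
have [w0 w0T] : exists w, w \in T by apply/card_gt0P; rewrite -ST.
have sz : size (enum S) = size (enum T) by rewrite -!cardE.
exists (fun x => nth w0 (enum T) (index x (enum S))).
exists (fun y => nth v0 (enum S) (index y (enum T))); split=> [x xS|x xS|y yT|y yT].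
- by rewrite -mem_enum mem_nth // -sz index_mem mem_enum.
- by rewrite index_uniq ?enum_uniq // -?sz ?index_mem ?nth_index ?mem_enum.
- by rewrite -mem_enum mem_nth // sz index_mem mem_enum.
by rewrite index_uniq ?enum_uniq // ?sz ?index_mem ?nth_index ?mem_enum.
Qed.

Lemma rank_clique (V W : finType) (S : {set V}) (T : {set W}) m :
    #|S| = #|T| -> (0 < #|S|)%N ->
  rank F (matchings (clique S)) m = rank F (matchings (clique T)) m.
Proof.
move=> ST S0; have [f [g [fST fK gTS gK]]] := bijection_sets ST S0.
by apply/eqP; rewrite eqn_leq (rank_transport _ gTS gK fST fK) (rank_transport _ fST fK gTS gK).
Qed.

End MatchingLists.

(** * Isotypic parts under swaps *)

Section Isotypic.
Variables (F : fieldType) (F2 : (2 : F) != 0) (n0 : nat) (dbl : bool).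
Local Notation n := n0.+1.
Local Notation V := ('I_n * bool)%type.
Local Notation grp := {ffun 'I_n -> bool}.
Local Notation bd := (boundary F {set V}).
Implicit Types (h : grp) (chi : {set 'I_n}) (e : {set V}) (l : seq {set V}) (m : nat).

(** Each node has the points [false] and [true] if [dbl] holds; otherwise it has one point, the swap
    group is trivial, and the method computes the rank in one piece. *)
Definition points : {set V} := [set p : V | p.2 ==> dbl].

Definition in_group h := [forall i, h i ==> dbl].

Definition act h (p : V) : V := (p.1, p.2 (+) h p.1).

Definition act_edge h e := act h @: e.

Definition swap_add h1 h2 : grp := [ffun i => h1 i (+) h2 i].

Lemma swap_add_in_group h1 h2 : in_group h1 -> in_group h2 -> in_group (swap_add h1 h2).
Proof.
move=> /forallP h1G /forallP h2G; apply/forallP => i; rewrite ffunE.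
by move: (h1G i) (h2G i); case: dbl (h1 i) (h2 i) => [] [] [].
Qed.

Lemma swap_add_invol h : involutive (swap_add h).
Proof. by move=> h1; apply/ffunP => i; rewrite !ffunE addKb. Qed.

Lemma act_act h1 h2 p : act h1 (act h2 p) = act (swap_add h1 h2) p.
Proof. by rewrite /act ffunE /= -addbA [h2 _ (+) _]addbC. Qed.

Lemma act_invol h : involutive (act h).
Proof. by move=> [i b]; rewrite /act /= addbK. Qed.

Lemma act_edge_act_edge h1 h2 e : act_edge h1 (act_edge h2 e) = act_edge (swap_add h1 h2) e.
Proof. by rewrite /act_edge -imset_comp; apply: eq_imset => p /=; rewrite act_act. Qed.

Lemma act_edge0 e : act_edge [ffun => false] e = e.
Proof.
rewrite /act_edge (eq_imset (g := id)) ?imset_id // => -[i b].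
by rewrite /act ffunE addbF.
Qed.

Lemma act_points h p : in_group h -> p \in points -> act h p \in points.
Proof.
by case: p => i b /forallP/(_ i); rewrite !inE /=; case: (h i) b dbl => [] [] [].
Qed.

(** The character of the swap group that is nontrivial exactly at the nodes of [chi]. *)
Definition char_sign chi h : F := \prod_(i in chi) (-1) ^+ h i.

Lemma char_sign_add chi h1 h2 : char_sign chi (swap_add h1 h2) = char_sign chi h1 * char_sign chi h2.
Proof. by rewrite /char_sign -big_split; apply: eq_bigr => i _; rewrite ffunE signr_addb. Qed.

(** The projection onto the isotypic part of [chi], multiplied by the group order to avoid a
    division. *)
Definition twist chi : 'End(chain F {set V}) :=
  \sum_(h | in_group h) char_sign chi h *: push F (act_edge h).

Lemma twist_osimp chi l : twist chi (osimp F l) =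
  \sum_(h | in_group h) char_sign chi h *: osimp F (map (act_edge h) l).
Proof.
rewrite /twist sum_lfunE; apply: eq_bigr => h _.
by rewrite scale_lfunE push_osimp.
Qed.

Lemma twist_boundary chi c : bd (twist chi c) = twist chi (bd c).
Proof.
rewrite /twist !sum_lfunE linear_sum; apply: eq_bigr => h _.
by rewrite !scale_lfunE linearZ /= push_boundary.
Qed.

Lemma twist_act chi h l : in_group h ->
  twist chi (osimp F (map (act_edge h) l)) = char_sign chi h *: twist chi (osimp F l).
Proof.
move=> hG; rewrite !twist_osimp scaler_sumr.
rewrite (reindex_inj (inv_inj (swap_add_invol h))) /=; apply: eq_big => h1.
  apply/idP/idP => h1G; last exact: swap_add_in_group.
  by rewrite -(swap_add_invol h h1) swap_add_in_group.
move=> _; rewrite char_sign_add scalerA -map_comp; congr (_ *: osimp F _).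
apply: eq_map => e /=; rewrite act_edge_act_edge; congr (act_edge _ e).
by apply/ffunP => i; rewrite !ffunE addbC addKb.
Qed.

Lemma twist_swap chi l1 e1 e2 l2 : twist chi (osimp F (l1 ++ e1 :: e2 :: l2)) =
  - twist chi (osimp F (l1 ++ e2 :: e1 :: l2)).
Proof. by rewrite osimp_swap linearN. Qed.

Definition chars : pred {set 'I_n} := fun chi => dbl || (chi == set0).

(** Orthogonality of characters: summed over all [chi], the signs of [h] give the product over the
    nodes of 1 + (-1)^(h i), which is zero unless [h] is trivial. The scalar is a power of 2,
    nonzero by [F2]. *)
Lemma sum_twist (c : chain F {set V}) :
  exists2 a : F, a != 0 & \sum_(chi | chars chi) twist chi c = a *: c.
Proof.
have push0 d : push F (act_edge [ffun => false]) d = d.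
  rewrite (chain_sum d) linear_sum; apply: eq_bigr => M _.
  rewrite linearZ /= -osimp_enum push_osimp; congr (_ *: osimp F _).
  by rewrite -[RHS]map_id; apply: eq_map => e; apply: act_edge0.
have sum_char_sign h : \sum_(chi : {set 'I_n}) char_sign chi h = \prod_i (1 + (-1) ^+ h i).
  under eq_bigr => i _ do rewrite addrC.
  by rewrite bigA_distr; apply: eq_bigr => chi _; rewrite /char_sign big_mkcond.
rewrite /chars; case: (boolP dbl) => [d|nd] /=.
  exists (2%:R ^+ n); first exact: expf_neq0.
  under eq_bigr => chi _ do rewrite /twist sum_lfunE.
  rewrite exchange_big /= (bigD1 [ffun => false]) /=; last first.
    by apply/forallP => i; rewrite ffunE.
  rewrite [X in _ + X]big1 ?addr0 => [|h /andP[_ h0]].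
    under eq_bigr => chi _ do rewrite scale_lfunE push0.
    rewrite -scaler_suml sum_char_sign (eq_bigr (fun=> 2%:R)) => [|i _].
      by rewrite prodr_const card_ord.
    by rewrite ffunE expr0 mulr2n.
  under eq_bigr => chi _ do rewrite scale_lfunE.
  rewrite -scaler_suml sum_char_sign; have [i hi] : exists i, h i.
    apply/existsP; apply: contraNT h0 => /existsPn h0; apply/eqP/ffunP => i.
    by rewrite ffunE; apply: negbTE.
  by rewrite (bigD1 i) //= hi expr1 subrr mul0r scale0r.
exists 1; first exact: oner_neq0.
rewrite big_pred1_eq scale1r /twist sum_lfunE (big_pred1 [ffun => false]) => [|h].
  by rewrite scale_lfunE push0 /char_sign big_set0 scale1r.
apply/forallP/eqP => [hG|-> i]; last by rewrite ffunE.
by apply/ffunP => i; have := hG i; rewrite ffunE (negbTE nd) implybF => /negbTE.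
Qed.

Definition isotypic chi m : {vspace chain F {set V}} :=
  (twist chi @: schains F (matchings (clique points)) m)%VS.

Lemma mlist_act_edge h l : in_group h -> mlist points l -> mlist points (map (act_edge h) l).
Proof.
move=> hG; apply: (@mlist_map _ _ (act h) (act h)) => [p pS|p _].
  exact: act_points.
exact: act_invol.
Qed.

Lemma isotypic_sub chi m : (isotypic chi m <= schains F (matchings (clique points)) m)%VS.
Proof.
apply/schains_mlist => l lS lm; rewrite twist_osimp memv_suml // => h hG.
by rewrite memvZ // -lm -(size_map (act_edge h)) osimp_schains // mlist_act_edge.
Qed.

Lemma isotypic_sum m :
  (\sum_(chi | chars chi) isotypic chi m)%VS = schains F (matchings (clique points)) m.
Proof.
apply/eqP; rewrite eqEsubv; apply/andP; split.
  by apply/subv_sumP => chi _; apply: isotypic_sub.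
apply/subvP => c cS; have [a a0 ac] := sum_twist c.
rewrite -(scalerK a0 c) -ac memvZ // memv_sumr // => chi _.
exact: memv_img.
Qed.

Section NodeMaps.
Variables (f g : 'I_n -> 'I_n) (fK : cancel f g) (gK : cancel g f).

Definition node_map (s : 'I_n -> 'I_n) (p : V) : V := (s p.1, p.2).

Definition node_edge (s : 'I_n -> 'I_n) e := node_map s @: e.

Lemma push_twist chi c : push F (node_edge f) (twist chi c) =
  twist (f @: chi) (push F (node_edge f) c).
Proof.
rewrite (chain_sum c) !linear_sum; apply: eq_bigr => M _; rewrite !linearZ /=.
congr (_ *: _); rewrite -osimp_enum push_osimp !twist_osimp linear_sum /=.
have hg_inj : injective (fun h : grp => [ffun i => h (g i)] : grp).
  move=> h1 h2 /ffunP h12; apply/ffunP => i; have := h12 (f i).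
  by rewrite !ffunE fK.
rewrite [RHS](reindex_inj hg_inj) /=; apply: eq_big => h.
  apply/forallP/forallP => hG i; first by rewrite ffunE.
  by have := hG (f i); rewrite ffunE fK.
move=> _; rewrite linearZ /= push_osimp -!map_comp; congr (_ *: osimp F _).
  rewrite /char_sign big_imset /=; last by move=> i j _ _; apply: (can_inj fK).
  by apply: eq_bigr => i _; rewrite ffunE fK.
apply: eq_map => e /=; rewrite /act_edge /node_edge -!imset_comp; apply: eq_imset => -[i b].
by rewrite /node_map /act /= ffunE fK.
Qed.

Lemma push_isotypic chi m :
  (push F (node_edge f) @: isotypic chi m = isotypic (f @: chi) m)%VS.
Proof.
have mapS l : mlist points l ->
    mlist points (map (node_edge f) l).
  apply: (@mlist_map _ _ (node_map f) (node_map g)) => [[i b]|[i b] _].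
    by rewrite !inE.
  by rewrite /node_map /= fK.
have mapS' l : mlist points l ->
    mlist points (map (node_edge g) l).
  apply: (@mlist_map _ _ (node_map g) (node_map f)) => [[i b]|[i b] _].
    by rewrite !inE.
  by rewrite /node_map /= gK.
apply/eqP; rewrite eqEsubv -limg_comp; apply/andP; split; apply/schains_mlist => l lS lm.
  rewrite comp_lfunE push_twist push_osimp memv_img // -lm.
  by rewrite -(size_map (node_edge f)) osimp_schains ?mapS.
pose l' := map (node_edge g) l.
have -> : osimp F l = push F (node_edge f) (osimp F l').
  rewrite push_osimp -map_comp map_id_in // => e _; rewrite /= /node_edge -imset_comp.
  by rewrite (eq_imset (g := id)) ?imset_id // => -[i b]; rewrite /node_map /= gK.
rewrite -push_twist -comp_lfunE memv_img // -lm.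
by rewrite -(size_map (node_edge g)) osimp_schains ?mapS'.
Qed.

End NodeMaps.

(** A permutation of the nodes carrying [chi2] to [chi1] is read off from the lists that put a
    subset before its complement; its push-forward maps one isotypic part onto the other and
    commutes with the boundary. *)
Lemma dim_isotypic_card chi1 chi2 m : #|chi1| = #|chi2| ->
  (\dim (isotypic chi1 m) <= \dim (isotypic chi2 m))%N /\
  (\dim (bd @: isotypic chi1 m) <= \dim (bd @: isotypic chi2 m))%N.
Proof.
move=> c12; pose s (chi : {set 'I_n}) := enum chi ++ enum (~: chi).
have us chi : uniq (s chi).
  rewrite cat_uniq !enum_uniq andbT /=; apply/hasPn => i.
  by rewrite !mem_enum inE.
have ms chi i : i \in s chi by rewrite mem_cat !mem_enum inE orbN.
have ss chi : size (s chi) = n.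
  by rewrite size_cat -!cardE cardsC card_ord.
have idx chi chi' i : (index i (s chi) < size (s chi'))%N.
  by rewrite [X in (_ < X)%N]ss -[X in (_ < X)%N](ss chi) index_mem.
pose f i := nth ord0 (s chi1) (index i (s chi2)).
pose g i := nth ord0 (s chi2) (index i (s chi1)).
have fK : cancel f g.
  by move=> i; rewrite /g index_uniq ?nth_index.
have gK : cancel g f.
  by move=> i; rewrite /f index_uniq ?nth_index.
have fchi : f @: chi2 = chi1.
  apply/eqP; rewrite eqEcard card_imset; last exact: can_inj fK.
  rewrite c12 leqnn andbT; apply/subsetP => _ /imsetP[i i2 ->].
  rewrite /f /s index_cat mem_enum i2 nth_cat -cardE.
  have i2e : i \in enum chi2 by rewrite mem_enum.
  by rewrite c12 cardE index_mem i2e -mem_enum mem_nth // -cardE c12 cardE index_mem.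
have dimle (W1 W2 : vectType F) (phi : 'Hom(W1, W2)) X : (\dim (phi @: X) <= \dim X)%N.
  by rewrite -(limg_ker_dim phi X) leq_addl.
have bdC X : (bd @: (push F (node_edge f) @: X) = push F (node_edge f) @: (bd @: X))%VS.
  rewrite -!limg_comp; congr (_ @: _)%VS; apply/lfunP => c.
  by rewrite !comp_lfunE push_boundary.
by rewrite -fchi -!(push_isotypic fK gK) bdC.
Qed.

End Isotypic.

(** * Normal words span the isotypic parts *)

Lemma occE i w : occ i w = (0 < deg i w)%N.
Proof.
by elim: w => //= a w ->; case: (i == a.1); case: (i == a.2).
Qed.

Lemma deg_cat i w1 w2 : deg i (w1 ++ w2) = (deg i w1 + deg i w2)%N.
Proof. by elim: w1 => //= a w1 ->; rewrite addnA. Qed.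

Lemma deg_rev i w : deg i (rev w) = deg i w.
Proof. by elim: w => //= a w IH; rewrite rev_cons -cats1 deg_cat IH /= addn0 addnC. Qed.

Lemma deg_cons i a w : deg i (a :: w) = (deg i [:: a] + deg i w)%N.
Proof. by rewrite -cat1s deg_cat. Qed.

(** The flag is the parity of the deleted position. *)
Fixpoint deletions (T : Type) (l : seq T) : seq (bool * seq T) :=
  if l is x :: l' then
    (false, l') :: [seq (~~ p.1, x :: p.2) | p <- deletions l']
  else [::].

Lemma boundary_osimp (F : fieldType) (V : finType) (l : seq V) :
  boundary F V (osimp F l) = \sum_(p <- deletions l) (-1) ^+ p.1 *: osimp F p.2.
Proof.
elim: l => [|x l IH]; first by rewrite boundary_face /face_boundary big_set0 big_nil.
rewrite osimp_cons boundary_cone IH /= big_cons expr0 scale1r big_map; congr (_ + _).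
rewrite linear_sum -sumrN; apply: eq_bigr => p _.
by rewrite linearZ /= signrN scaleNr.
Qed.

Section Words.
Variables (F : fieldType) (F2 : (2 : F) != 0) (n0 : nat) (dbl : bool).
Local Notation n := n0.+1.
Local Notation V := ('I_n * bool)%type.
Local Notation grp := {ffun 'I_n -> bool}.
Local Notation bd := (boundary F {set V}).
Implicit Types (h : grp) (e : {set V}) (l : seq {set V}) (m : nat) (w u v : word) (a b : letter).

Variables (k : nat) (kn : (k <= n)%N) (kdbl : (0 < k)%N -> dbl).

Definition chi0 : {set 'I_n} := [set i : 'I_n | (i < k)%N].

Definition pt (i : nat) (b : bool) : V := (inord i, b).

(* The last edge of [w] at node [i] uses the point [(i, false)], an earlier
   one uses [(i, true)]; [edge a v] is the edge of letter [a] followed by [v]. *)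
Definition edge a v : {set V} :=
  [set pt a.1 (occ a.1 v); pt a.2 (occ a.2 v || (a.1 == a.2))].

(** The edges of [u] when [v] follows: the choice of points depends on the letters to come. *)
Fixpoint dec_prefix u v : seq {set V} :=
  if u is a :: u' then edge a (u' ++ v) :: dec_prefix u' v else [::].

Definition dec w := dec_prefix w [::].

Lemma dec_prefix_cat u1 u2 v : dec_prefix (u1 ++ u2) v = dec_prefix u1 (u2 ++ v) ++ dec_prefix u2 v.
Proof. by elim: u1 => //= a u1 ->; rewrite catA. Qed.

Lemma dec_cat u v : dec (u ++ v) = dec_prefix u v ++ dec v.
Proof. by rewrite /dec dec_prefix_cat cats0. Qed.

Lemma dec_cons a v : dec (a :: v) = edge a v :: dec v.
Proof. by rewrite /dec /= cats0. Qed.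

Lemma size_dec_prefix u v : size (dec_prefix u v) = size u.
Proof. by elim: u => //= a u ->. Qed.

Definition bounded w := all (fun a => (a.1 <= n0) && (a.2 <= n0))%N w.

Definition valid w := bounded w /\ forall i, (deg i w <= capacity dbl)%N.

Lemma capacityE : capacity dbl = dbl.+1. Proof. by case: dbl. Qed.

Lemma valid_perm u v : perm_eq u v -> valid u -> valid v.
Proof.
move=> uv [bu du]; split; first by rewrite /bounded -(perm_all _ uv).
have degE i w : deg i w = sumn [seq ((i == a.1) + (i == a.2))%N | a <- w].
  by elim: w => //= a w ->.
by move=> i; rewrite degE -(perm_sumn (perm_map _ uv)) -degE.
Qed.

Definition flip (Q : nat -> bool) : grp := [ffun i : 'I_n => Q i].

Lemma flipE Q i : (i <= n0)%N -> flip Q (inord i) = Q i.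
Proof. by move=> ni; rewrite ffunE inordK. Qed.

(** An edge depends on the letters after it only through the occupation of its nodes, and a change
    of occupation is a swap. A loop uses both points of its node, so swaps fix it. *)
Lemma act_edge_edge Q a v v' : (a.1 <= n0)%N -> (a.2 <= n0)%N ->
    (a.1 = a.2 -> occ a.1 v = false /\ occ a.1 v' = false) ->
    (a.1 <> a.2 -> forall i, occ i [:: a] -> occ i v' = occ i v (+) Q i) ->
  act_edge (flip Q) (edge a v) = edge a v'.
Proof.
case: a => i j /= ni nj Hl Hn; rewrite /act_edge /edge imsetU !imset_set1 /act /= !flipE //.
have [ij|ij] := eqVneq i j.
  rewrite -ij; have [-> ->] := Hl ij; rewrite /= /pt.
  by case: (Q i) => //=; rewrite setUC.
by rewrite !orbF /pt -!Hn ?eqxx ?orbT //; apply/eqP.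
Qed.

Lemma act_edge_fix Q s x : bounded s -> (forall i, occ i s -> Q i = false) ->
  map (act_edge (flip Q)) (dec_prefix s x) = dec_prefix s x.
Proof.
elim: s => //= c s IH /andP[/andP[c1 c2] bs] Qs; rewrite IH // => [|i si].
  congr (_ :: _); rewrite /act_edge /edge imsetU !imset_set1 /act /= !flipE //.
  by rewrite !Qs ?eqxx ?orbT // !addbF.
by rewrite Qs ?si ?orbT.
Qed.

Lemma eq_dec_prefix s x y : (forall i, occ i x = occ i y) -> dec_prefix s x = dec_prefix s y.
Proof.
move=> xy; elim: s => //= c s ->; congr (_ :: _); rewrite /edge.
by rewrite /occ !has_cat -!/(occ _ _) !xy.
Qed.

Definition twist0 := twist F dbl chi0.
Definition Phi w := twist0 (osimp F (dec w)).

Lemma flip_in_group (Q : nat -> bool) : (forall i, Q i -> dbl) -> in_group dbl (flip Q).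
Proof. by move=> Qd; apply/forallP => i; rewrite ffunE; apply/implyP/Qd. Qed.

Lemma char_sign_flip a (Q : nat -> bool) : (a.1 <= n0)%N -> (a.2 <= n0)%N ->
    (a.1 = a.2 -> Q a.1 = false) ->
  char_sign F chi0 (flip (fun i => occ i [:: a] && Q i)) =
    (-1) ^+ (((a.1 < k)%N && Q a.1) (+) ((a.2 < k)%N && Q a.2)).
Proof.
case: a => x y /= nx ny Qxy.
have single z : (z <= n0)%N ->
    \prod_(i : 'I_n) (-1) ^+ ((i == z :> nat) && ((z < k)%N && Q z)) =
      (-1) ^+ ((z < k)%N && Q z) :> F.
  move=> nz; rewrite (bigD1 (inord z)) //= inordK // eqxx /= big1 ?mulr1 // => i iz.
  have -> : (i == z :> nat) = false.
    by apply: contraNF iz => /eqP <-; rewrite inord_val.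
  by rewrite expr0.
rewrite signr_addb -(single x nx) -(single y ny) -big_split /char_sign big_mkcond /=.
apply: eq_bigr => i _; rewrite !inE ffunE -signr_addb orbF.
case: (eqVneq (i : nat) x) => [ix|_]; case: (eqVneq (i : nat) y) => [iy|_] /=.
- by rewrite -ix -iy addbb ix Qxy -?ix // if_same.
- by rewrite -ix addbF; case: (i < k)%N.
- by rewrite -iy; case: (i < k)%N.
by rewrite if_same.
Qed.

(* Deleting the letter [a] lowers the earlier edge at a node shared with [a]
   from the point [true] to the point [false]. *)
Lemma dec_remove u a v : valid (u ++ a :: v) ->
  let h := flip (fun i => occ i [:: a] && occ i u) in
  [/\ in_group dbl h, dec_prefix u (a :: v) ++ dec v = map (act_edge h) (dec (u ++ v)) &
      char_sign F chi0 h = (-1) ^+ deletion_sign k a u].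
Proof.
case=> bw dw h; have dwE i : (deg i u + (deg i [:: a] + deg i v) <= capacity dbl)%N.
  by have := dw i; rewrite deg_cat deg_cons.
move: bw; rewrite /bounded all_cat /= => /and3P[bu /andP[a1 a2] bv].
split.
- apply: flip_in_group => i; rewrite !occE => /andP[]; have := dwE i; rewrite capacityE.
  by case: dbl => //; lia.
- rewrite dec_cat map_cat; congr (_ ++ _).
    have part s : (forall i, deg i s <= deg i u)%N -> bounded s ->
        dec_prefix s (a :: v) = map (act_edge h) (dec_prefix s v).
      elim: s => //= b s IH dle /andP[/andP[b1 b2] bs].
      rewrite -IH //; last by move=> i; have := dle i; lia.
      congr (_ :: _); apply/esym/act_edge_edge => //.
        move=> b12; have := dle b.1; have := dwE b.1.
        rewrite !occE !deg_cat deg_cons -b12 eqxx capacityE; case: (dbl) => /=; lia.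
      move=> _ i ib; have iu : occ i u.
        by have := dle i; move: ib; rewrite !occE /= addn0; lia.
      rewrite iu andbT !occE !deg_cat deg_cons; have := dle i; have := dwE i.
      by move: ib; rewrite occE capacityE /= !addn0; case: (dbl); lia.
    exact: part.
  rewrite act_edge_fix // => i; rewrite !occE => iv; have := dwE i; rewrite capacityE.
  by apply: contra_leqF => /andP[]; case: (dbl); lia.
rewrite char_sign_flip // => a12; have := dwE a.1; rewrite occE capacityE /= -a12 eqxx.
by case: (dbl); lia.
Qed.

Lemma deg_letter2 i a : (deg i [:: a] = (i == a.1) + (i == a.2))%N.
Proof. by rewrite /= addn0. Qed.

(** Exchanging adjacent letters affects only the nodes they share, where the swap [h] interchanges
    the two points. *)
Lemma dec_swap u a b v : valid (u ++ a :: b :: v) ->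
  let h := flip (fun i => occ i [:: a] && occ i [:: b]) in
  [/\ in_group dbl h,
      map (act_edge h) (dec (u ++ a :: b :: v)) =
        dec_prefix u (b :: a :: v) ++ edge a v :: edge b (a :: v) :: dec v &
      char_sign F chi0 h =
        (-1) ^+ (((a.1 < k)%N && occ a.1 [:: b]) (+) ((a.2 < k)%N && occ a.2 [:: b]))].
Proof.
case=> bw dw h.
have dwE i : (deg i u + (deg i [:: a] + (deg i [:: b] + deg i v)) <= capacity dbl)%N.
  by have := dw i; rewrite deg_cat (deg_cons _ a) (deg_cons _ b).
move: bw; rewrite /bounded all_cat /= => /and4P[bu /andP[a1 a2] /andP[b1 b2] bv].
split.
- apply: flip_in_group => i; rewrite !occE => /andP[]; have := dwE i; rewrite capacityE.
  by case: (dbl) => //; lia.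
- rewrite dec_cat map_cat; congr (_ ++ _).
    rewrite act_edge_fix // => [|i]; first by apply: eq_dec_prefix => i; rewrite /= orbCA.
    rewrite !occE => iu; have := dwE i; rewrite capacityE.
    by apply: contra_leqF => /andP[]; case: (dbl); lia.
  rewrite !dec_cons /=.
  congr [:: _, _ & _].
  - apply: act_edge_edge => //.
      move=> a12; have := dwE a.1; rewrite !occE /= -a12 eqxx capacityE.
      by case: (dbl); lia.
    move=> _ i; have := dwE i; rewrite !occE (deg_cons _ b v) capacityE.
    move: (deg i [:: a]) (deg i [:: b]) (deg i v) => [|da] [|db] [|dv] //=.
    by case: (dbl); lia.
  - apply: act_edge_edge => //.
      move=> b12; have := dwE b.1; rewrite !occE /= -b12 eqxx capacityE.
      by case: (dbl); lia.
    move=> _ i; have := dwE i; rewrite !occE (deg_cons _ a v) capacityE.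
    move: (deg i [:: a]) (deg i [:: b]) (deg i v) => [|da] [|db] [|dv] //=.
    by case: (dbl); lia.
  rewrite act_edge_fix // => i; rewrite !occE => iv; have := dwE i; rewrite capacityE.
  by apply: contra_leqF => /andP[]; case: (dbl); lia.
rewrite char_sign_flip // => a12; have := dwE a.1; rewrite occE capacityE (deg_letter2 _ a) -a12 eqxx.
by case: (dbl); lia.
Qed.

(** The minus sign comes from transposing two edges, the exponent from the character of the swaps in
    [dec_swap]. *)
Lemma PhiC u a b v : valid (u ++ a :: b :: v) ->
  Phi (u ++ a :: b :: v) =
    - (-1) ^+ (((a.1 < k)%N && occ a.1 [:: b]) (+) ((a.2 < k)%N && occ a.2 [:: b]))
      *: Phi (u ++ b :: a :: v).
Proof.
move=> w_val; have [hG E sgnE] := dec_swap w_val.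
have : twist0 (osimp F (map (act_edge (flip (fun i => occ i [:: a] && occ i [:: b])))
    (dec (u ++ a :: b :: v)))) = - Phi (u ++ b :: a :: v).
  by rewrite E /twist0 twist_swap /Phi dec_cat !dec_cons.
by rewrite /twist0 twist_act // sgnE scaleNr -scalerN => /(canRL (signrZK _)).
Qed.

(** The twist equals its own negative, and 2 is invertible. *)
Lemma Phi_fixed h l : in_group dbl h -> char_sign F chi0 h = -1 -> map (act_edge h) l = l ->
  twist0 (osimp F l) = 0.
Proof.
move=> hG h1 hl; have := twist_act F chi0 l hG.
rewrite h1 hl scaleN1r -/twist0 => /eqP; rewrite -subr_eq0 opprK -mulr2n -scaler_nat.
by rewrite scaler_eq0 (negbTE F2) => /eqP.
Qed.

Lemma char_sign_delta i : (i < k)%N -> char_sign F chi0 (flip (fun j => j == i)) = -1.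
Proof.
move=> ik; have ni : (i < n)%N by apply: leq_trans ik kn.
rewrite /char_sign (bigD1 (Ordinal ni)) ?inE //= ffunE eqxx big1 ?mulr1 // => j.
by case/andP=> _ ji; rewrite ffunE (_ : (j == i :> nat) = false) //; apply: negbTE.
Qed.

Lemma delta_in_group i : (i < k)%N -> in_group dbl (flip (fun j => j == i)).
Proof. by move=> ik; apply: flip_in_group => j _; apply: kdbl; apply: leq_ltn_trans ik. Qed.

Lemma Phi_isolated w : bounded w -> ~~ meets_below k w -> Phi w = 0.
Proof.
move=> bw /allPn[i]; rewrite mem_iota add0n => /andP[_ ik] iw.
apply: (Phi_fixed (delta_in_group ik) (char_sign_delta ik)).
by rewrite act_edge_fix // => j jw; apply: contraNF iw => /eqP <-.
Qed.

(** The swap at [i] interchanges the ends of the loop, and the degree bound keeps every other edge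
    away from [i]. *)
Lemma Phi_loop u i v : valid (u ++ (i, i) :: v) -> (i < k)%N ->
  Phi (u ++ (i, i) :: v) = 0.
Proof.
move=> w_val ik; apply: (Phi_fixed (delta_in_group ik) (char_sign_delta ik)).
have [bw dw] := w_val; have := dw i; rewrite deg_cat deg_cons /= eqxx capacityE => di.
move: bw; rewrite /bounded all_cat /= => /and3P[bu /andP[i1 _] bv].
rewrite dec_cat dec_cons map_cat /=.
have iu : deg i u = 0%N by move: di; case: (dbl); lia.
have iv : deg i v = 0%N by move: di; case: (dbl); lia.
have fix0 s x : bounded s -> deg i s = 0%N ->
    map (act_edge (flip (fun j => j == i))) (dec_prefix s x) = dec_prefix s x.
  move=> bs s0; apply: act_edge_fix => // j; rewrite occE.
  by apply: contraTF => /eqP->; rewrite s0.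
rewrite (fix0 u) // (fix0 v) //; congr (_ ++ _ :: _).
by apply: act_edge_edge => //= _; rewrite occE iv.
Qed.

(** Exchanging the two copies of [a] gives the sign -1, as the characters of the swaps at its two
    nodes cancel when the nodes have the same type. *)
Lemma Phi_double u a v : valid (u ++ a :: a :: v) -> (a.1 < k)%N = (a.2 < k)%N ->
  Phi (u ++ a :: a :: v) = 0.
Proof.
move=> w_val ak; have := PhiC w_val; rewrite /= !eqxx !orbT !andbT ak addbb expr0 scaleN1r.
move/eqP; rewrite -subr_eq0 opprK -mulr2n -scaler_nat.
by rewrite scaler_eq0 (negbTE F2) => /eqP.
Qed.

Lemma Phi_move u a v1 v2 : valid (u ++ a :: v1 ++ v2) ->
  exists s : bool, Phi (u ++ a :: v1 ++ v2) = (-1) ^+ s *: Phi (u ++ v1 ++ a :: v2).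
Proof.
elim: v1 u => [|b v1 IH] u w_val; first by exists false; rewrite expr0 scale1r.
have w_val' : valid (rcons u b ++ a :: v1 ++ v2).
  apply: valid_perm w_val; rewrite cat_rcons perm_cat2l.
  exact: permEl (perm_catCA [:: a] [:: b] _).
have [s E] := IH _ w_val'; rewrite PhiC //.
set t := (_ (+) _); exists (~~ t (+) s).
by rewrite -cat_rcons E cat_rcons scaleNr scalerA -scaleNr -mulNr signr_addb signrN.
Qed.

Lemma Phi_perm u w w' : perm_eq w w' -> valid (u ++ w) ->
  exists s : bool, Phi (u ++ w) = (-1) ^+ s *: Phi (u ++ w').
Proof.
elim: w' u w => [|a w' IH] u w pw w_val.
  by exists false; move/perm_nilP: pw => ->; rewrite expr0 scale1r.
have aw : a \in w by rewrite (perm_mem pw) mem_head.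
have [v1 [v2 wE]] : exists v1 v2, w = v1 ++ a :: v2.
  by case: (path.splitPr aw) => v1 v2; exists v1, v2.
rewrite wE in pw w_val *.
have pw' : perm_eq (v1 ++ v2) w'.
  by rewrite -(perm_cons a) -(permPr pw) (perm_catCA [:: a] v1 v2).
have w_val' : valid (u ++ a :: v1 ++ v2).
  apply: valid_perm w_val; rewrite perm_cat2l.
  exact: permEl (perm_catCA v1 [:: a] v2).
have [s E] := Phi_move w_val'.
have [t] : exists t : bool, Phi (rcons u a ++ v1 ++ v2) = (-1) ^+ t *: Phi (rcons u a ++ w').
  by apply: IH => //; rewrite cat_rcons.
rewrite !cat_rcons => E'.
exists (s (+) t); move: E; rewrite E' => /esym/(canRL (signrZK s)) ->.
by rewrite scalerA signr_addb.
Qed.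

(** The passed prefix enters the induction because deleting a letter moves earlier edges;
    [dec_remove] undoes this by a swap, whose character is [deletion_sign]. *)
Lemma Phi_terms pre s v : valid (rev pre ++ v) ->
  \sum_(p <- deletions (dec v))
      (-1) ^+ (s (+) p.1) *: twist0 (osimp F (dec_prefix (rev pre) v ++ p.2)) =
  \sum_(p <- deletion_terms k pre s v) (-1) ^+ p.1 *: Phi p.2.
Proof.
elim: v pre s => [|a v IH] pre s w_val; first by rewrite !big_nil.
rewrite dec_cons /= !big_cons big_map /=; congr (_ + _).
  have [hG -> sgnE] := dec_remove w_val.
  rewrite /twist0 twist_act // sgnE scalerA -signr_addb addbF catrevE.
  congr ((-1) ^+ _ *: _); congr (_ (+) _).
  by rewrite /deletion_sign !occE !deg_rev.
have w_val' : valid (rev (a :: pre) ++ v) by rewrite rev_cons cat_rcons.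
rewrite -(IH (a :: pre)) //; apply: eq_bigr => p _.
congr ((-1) ^+ _ *: twist0 (osimp F _)); first by case: s (p.1) => [] [].
by rewrite rev_cons -cats1 dec_prefix_cat /= -catA.
Qed.

Lemma Phi_boundary w : valid w ->
  bd (Phi w) = \sum_(p <- deletion_terms k [::] false w) (-1) ^+ p.1 *: Phi p.2.
Proof.
move=> w_val; rewrite -(Phi_terms (pre := [::])) // /Phi /twist0 twist_boundary boundary_osimp.
rewrite linear_sum; apply: eq_bigr => p _.
by rewrite linearZ addFb.
Qed.

Lemma deletion_terms_mem pre s v p : p \in deletion_terms k pre s v ->
  exists u a v', rev pre ++ v = u ++ a :: v' /\ p.2 = u ++ v'.
Proof.
elim: v pre s => //= a v IH pre s; rewrite inE => /predU1P[->|/IH].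
  by exists (rev pre), a, v; rewrite catrevE.
by rewrite rev_cons cat_rcons.
Qed.

Definition good_letter a := (a \in letters n) && ((a.1 == a.2) ==> ~~ (a.1 < k)%N).

Definition below a b := letter_le a b && ~~ ((a == b) && ((a.1 < k)%N == (a.2 < k)%N)).

(** The global form of [extends]: [below] is required of all pairs, so it survives the deletion of a
    letter. *)
Definition canonical w :=
  [/\ pairwise below w, all good_letter w & forall i, (deg i w <= capacity dbl)%N].

Lemma mem_letters a : (a \in letters n) = (a.1 <= a.2)%N && (a.2 <= n0)%N.
Proof.
case: a => i j /=; apply/flatten_mapP/idP => [[x _ /mapP[y + [-> ->]]]|].
  by rewrite !mem_iota; lia.
case/andP=> ij jn; exists i; first by rewrite mem_iota; lia.
by apply/mapP; exists j => //; rewrite mem_iota; lia.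
Qed.

Lemma letter_le_trans : transitive letter_le.
Proof. move=> [b1 b2] [a1 a2] [c1 c2]; rewrite /letter_le /=; lia. Qed.

Lemma letter_le_anti a b : letter_le a b -> letter_le b a -> a = b.
Proof.
case: a b => [a1 a2] [b1 b2]; rewrite /letter_le /= => ab ba.
have -> : a1 = b1 by lia.
by have -> : a2 = b2 by lia.
Qed.

(** By antisymmetry, equal outer letters force the middle one to agree with them. Hence comparing
    neighbours, as [extends] does, is enough. *)
Lemma below_trans : transitive below.
Proof.
move=> b a c /andP[ab nab] /andP[bc nbc]; rewrite /below (letter_le_trans ab bc) /=.
apply: contra nab => /andP[/eqP ac aa]; rewrite aa andbT.
by apply/eqP/letter_le_anti => //; rewrite ac.
Qed.

Lemma canonical_valid w : canonical w -> valid w.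
Proof.
case=> _ /allP gw dw; split=> //; apply/allP => a /gw /andP[]; rewrite mem_letters.
by lia.
Qed.

Lemma canonical_cons a w : canonical (a :: w) -> canonical w.
Proof.
case=> /= /andP[_ pw] /andP[_ gw] dw; split=> // i.
by apply: leq_trans (leq_addl _ _) (dw i).
Qed.

Lemma prenormalP m w : reflect
  (exists a w', [/\ w = a :: w', a \in letters n, w' \in prenormal n dbl k m &
     extends dbl k a w'])
  (w \in prenormal n dbl k m.+1).
Proof.
apply: (iffP (@flatten_mapP _ _ _ _ _)) => [[a an /mapP[w' + ->]]|[a [w' [-> an w'm aw']]]].
  by rewrite mem_filter => /andP[aw' w'm]; exists a, w'.
by exists a => //; rewrite map_f // mem_filter aw'.
Qed.

Lemma canonical_prenormal w : canonical w -> w \in prenormal n dbl k (size w).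
Proof.
elim: w => // a w IH aw_can; have := IH (canonical_cons aw_can).
case: aw_can => /= /andP[/allP below_a _] /andP[/andP[an loop_a] _] da w_pre.
apply/prenormalP; exists a, w; split=> //; rewrite /extends /= !da !andbT; apply/andP; split.
  by case: w below_a {IH da w_pre} => // b w /(_ b (mem_head _ _)).
by case: ifP loop_a => //= ->.
Qed.

Lemma prenormal_canonical m w : w \in prenormal n dbl k m -> canonical w /\ size w = m.
Proof.
elim: m w => [|m IH] w; first by rewrite inE => /eqP->.
case/prenormalP => a [{}w [-> an /IH[[pw gw dw] <-] /and4P[ha la d1 d2]]].
split=> //; split=> /=.
- rewrite pw andbT; case: w pw ha {IH gw dw d1 d2} => //= b w /andP[/allP bw _] ab.
  apply/andP; split=> //; apply/allP => c /bw; apply: below_trans ab.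
- by rewrite gw andbT /good_letter an; case: ifP la => //= _ ->.
move=> i; have [->|ia1] := eqVneq i a.1; first by move: d1; rewrite /= eqxx.
have [->|ia2] := eqVneq i a.2; first by move: d2; rewrite /= eqxx; lia.
exact: dw.
Qed.

Lemma canonical_delete u a v : canonical (u ++ a :: v) -> canonical (u ++ v).
Proof.
case; rewrite !pairwise_cat !all_cat /= => /and3P[uv pu /andP[_ pv]] /and3P[gu _ gv] d.
split; rewrite ?pairwise_cat ?all_cat ?gu ?pu ?pv ?gv ?andbT //=.
  by move: uv; rewrite allrel_consr => /andP[].
by move=> i; have := d i; rewrite !deg_cat /=; lia.
Qed.

Lemma mem_normal m w :
  reflect [/\ canonical w, size w = m & meets_below k w] (w \in normal n dbl k m).
Proof.
rewrite mem_filter; apply: (iffP andP) => [[aw /prenormal_canonical[]]|[cw <- aw]] //.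
by rewrite aw canonical_prenormal.
Qed.

Lemma eq_act_edge h1 h2 s x : (forall i : 'I_n, occ i s -> h1 i = h2 i) -> bounded s ->
  map (act_edge h1) (dec_prefix s x) = map (act_edge h2) (dec_prefix s x).
Proof.
elim: s => //= c s IH h12 /andP[/andP[c1 c2] bs]; rewrite IH // => [|i si].
  congr (_ :: _); rewrite /act_edge /edge !imsetU !imset_set1 /act /=.
  by rewrite !h12 ?inordK ?eqxx ?orbT.
by rewrite h12 ?si ?orbT.
Qed.

Lemma occ_dec i w : occ i w -> exists2 e, e \in dec w & pt i false \in e.
Proof.
elim: w => // a w IH; rewrite dec_cons; case: (boolP (occ i w)) => [/IH[e ew ie] _|iw].
  by exists e; rewrite // inE ew orbT.
rewrite /= (negbTE iw) orbF => ia; exists (edge a w); first exact: mem_head.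
rewrite !inE; case: (eqVneq i a.1) ia => [<- _|ia /= /eqP ia2].
  by rewrite (negbTE iw) eqxx.
by rewrite -ia2 (negbTE iw) (eq_sym a.1) (negbTE ia) eqxx orbT.
Qed.

Local Notation points := (points n0 dbl).

Definition covers l (p : V) : bool := has (fun e => p \in e) l.

Lemma card_fiber (i : 'I_n) (p q : V) : p != q ->
  (((i, false) \in [set p; q]) + ((i, true) \in [set p; q]) =
    (i == p.1 :> nat) + (i == q.1 :> nat))%N.
Proof.
have ordE (z : 'I_n) : (i == z :> nat) = (i == z) by [].
case: p q => [x b] [y c]; rewrite !inE !xpair_eqE /= !ordE.
by case: (eqVneq i x) => [<-|_]; case: (eqVneq i y) => _; case: b c => [] [].
Qed.

(** Built from the end of the list. At a node not met so far the swap is chosen so that the point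
    [false] goes to the endpoint of the new edge; at a node already met only one point is left. The
    degree formula later yields [valid]. *)
Lemma mlist_dec l : mlist points l -> exists w h,
  [/\ all (fun a => a \in letters n) w, in_group dbl h, l = map (act_edge h) (dec w) &
      forall i : 'I_n, deg i w = (covers l (i, false) + covers l (i, true))%N].
Proof.
elim: l => [_|e l IH /mlistP[/= /andP[el ul] lS lt]].
  by exists [::], [ffun => false]; split=> //; apply/forallP => i; rewrite ffunE.
have [|w [h [w_let hG l_dec w_deg]]] := IH.
  by apply/mlistP; split=> // [f fl|f g fl gl]; [apply: lS | apply: lt]; rewrite inE ?fl ?gl orbT.
have [eS /eqP/cards2P[p0 [q0 [pq0 e0]]]] := lS e (mem_head _ _).
have [p [q [pq e_pq pq_le]]] : exists p q : V,
    [/\ p != q, e = [set p; q] & (p.1 <= q.1)%N].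
  case/orP: (leq_total p0.1 q0.1) => [le|le]; first by exists p0, q0.
  by exists q0, p0; rewrite eq_sym setUC.
have disj f : f \in l -> [disjoint e & f].
  move=> fl; apply: lt; rewrite ?mem_head ?inE ?fl ?orbT //.
  by apply: contraNneq el => ->.
have bw : bounded w.
  apply/allP => a /(allP w_let); rewrite mem_letters => /andP[le1 le2].
  by rewrite le2 (leq_trans le1 le2).
(* At a node occurring in [w], the image of the point [false] is already covered, so [e] must use
   the other point. *)
have used (r : V) : r \in e -> occ r.1 w -> r.2 = ~~ h r.1.
  move=> re /occ_dec[f fw rf].
  have rhf : (r.1, h r.1) \in act_edge h f.
    by apply/imsetP; exists (pt r.1 false); rewrite // /act /pt /= inord_val.
  have hNe : (r.1, h r.1) \in e = false by apply: (disjointFl (disj (act_edge h f) _) rhf); rewrite l_dec map_f.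
  case: (eqVneq r.2 (h r.1)) => [rh|]; last by case: r.2 (h r.1) => [] [].
  by move: hNe; rewrite -rh -surjective_pairing re.
have pe : p \in e by rewrite e_pq set21.
have qe : q \in e by rewrite e_pq set22.
pose h1 : grp := [ffun i : 'I_n => if occ i w then h i else
  if i == p.1 then p.2 else if i == q.1 then q.2 else h i].
have dblP r : r \in e -> r.2 -> dbl.
  by move/(subsetP eS); rewrite inE => /implyP.
exists ((p.1 : nat, q.1 : nat) :: w), h1; split.
- by rewrite /= w_let andbT mem_letters /= pq_le -ltnS ltn_ord.
- apply/forallP => i; rewrite ffunE; have := forallP hG i.
  by case: ifP => // _; case: ifP => _; [|case: ifP => _] => // _; apply/implyP/dblP.
- rewrite dec_cons /= l_dec; congr (_ :: _); last first.
    by apply: eq_act_edge => // i iw; rewrite ffunE iw.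
  rewrite {1}e_pq /act_edge /edge imsetU !imset_set1 /act /= !inord_val !ffunE eqxx.
  have usedp := used p pe; have usedq := used q qe.
  case: p q pq {pe qe e_pq pq_le h1} usedp usedq => [x b] [y c] /= xy usedp usedq.
  case: (eqVneq x y) xy usedq => [<-|xy] bc usedq.
    have {}bc : b != c by apply: contraNneq bc => ->.
    have xw : occ x w = false.
      by apply: contraNF bc => xw; rewrite usedp // usedq.
    rewrite xw eqxx /=; congr [set _; (x, _)].
    by case: b c bc {usedp usedq} => [] [].
  have -> : (x == y :> nat) = false by apply: negbTE xy.
  rewrite orbF eqxx (_ : occ x w (+) _ = b); last by case: ifP => // /usedp ->.
  by rewrite (_ : occ y w (+) _ = c) //; case: ifP => // /usedq ->.
move=> i.
have cov r : covers (e :: l) r = ((r \in e) + covers l r)%N :> nat.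
  rewrite /covers /=; case re: (r \in e) => //=; rewrite [has _ _]negbTE //.
  by apply/hasPn => f /disj/disjointFr/(_ re) ->.
rewrite !cov addnACA -w_deg [LHS]/=; congr (_ + _)%N.
by rewrite e_pq card_fiber.
Qed.

Lemma mlist_dec_valid l w h : mlist points l -> all (fun a => a \in letters n) w ->
    (forall i : 'I_n, deg i w = (covers l (i, false) + covers l (i, true))%N) ->
  valid w.
Proof.
case/mlistP=> _ lS _ w_let w_deg.
have bw : bounded w.
  apply/allP => a /(allP w_let); rewrite mem_letters => /andP[le1 le2].
  by rewrite le2 (leq_trans le1 le2).
split=> // i; have [ni|ni] := leqP i n0; last first.
  have -> : deg i w = 0%N.
    elim: w bw {w_let w_deg} => //= a w IH /andP[/andP[a1 a2] /IH->].
    by rewrite !gtn_eqF // (leq_ltn_trans _ ni).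
  by rewrite capacityE.
have := w_deg (inord i); rewrite inordK // => ->; rewrite capacityE.
case: (boolP dbl) => [_|nd]; first by do 2!case: (covers _ _).
rewrite [covers l (_, true)]negbTE ?addn0; first by case: (covers _ _).
apply/hasPn => e /lS[eS _]; apply/negP => /(subsetP eS).
by rewrite inE /= (negbTE nd).
Qed.

Lemma sorted_below w : sorted letter_le w ->
  sorted below w \/ exists u a v, w = u ++ a :: a :: v /\ (a.1 < k)%N = (a.2 < k)%N.
Proof.
elim: w => [|a w IH] /=; first by left.
case: w IH => [|b w] IH /=; first by left.
case/andP => ab /IH[sw|[u [c [v [-> ck]]]]]; last by right; exists (a :: u), c, v.
case: (boolP (below a b)) => [_|]; first by left.
rewrite /below ab /= negbK => /andP[/eqP<- /eqP ak].
by right; exists [::], a, w.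
Qed.

(** Sorting changes [Phi w] only by a sign. A sorted word is normal unless it misses a node below
    [k], repeats a letter whose nodes have the same type, or has a loop below [k]; in these cases
    [Phi] vanishes. *)
Lemma Phi_span w : valid w -> all (fun a => a \in letters n) w ->
  Phi w \in <<map Phi (normal n dbl k (size w))>>%VS.
Proof.
move=> w_val w_let; pose w' := sort letter_le w.
have ww' : perm_eq w w' by rewrite perm_sym; apply/permPl/perm_sort.
have [s ->] := Phi_perm (u := [::]) ww' w_val; apply: memvZ.
have w'_val := valid_perm ww' w_val; have [bw' dw'] := w'_val.
have w'_let : all (fun a => a \in letters n) w' by rewrite -(perm_all _ ww').
have [aw|/(Phi_isolated bw')->] := boolP (meets_below k w'); last exact: mem0v.
have letter_le_total : total letter_le by case=> [a1 a2] [b1 b2]; rewrite /letter_le /=; lia.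
case: (sorted_below (sort_sorted letter_le_total w)) => [sw|[u [a [v [E ak]]]]]; last first.
  have {}E : w' = u ++ a :: a :: v := E.
  by rewrite /= E Phi_double ?mem0v // -E.
case: (boolP (all good_letter w')) => [gw|/allPn[a aw' ga]]; last first.
  move: ga; rewrite negb_and (allP w'_let) //= negb_imply negbK => /andP[/eqP a12 ak].
  have [u [v E]] : exists u v, w' = u ++ (a.1, a.1) :: v.
    case: (path.splitPr aw') => u v; exists u, v.
    by rewrite {2}a12 -surjective_pairing.
  by rewrite /= E Phi_loop ?mem0v // -E.
apply/memv_span/map_f/mem_normal; split=> //; last exact/esym/perm_size.
split=> //; by rewrite -sorted_pairwise //; apply: below_trans.
Qed.

Lemma twist0_span l : mlist points l ->
  twist0 (osimp F l) \in <<map Phi (normal n dbl k (size l))>>%VS.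
Proof.
move=> lS; have [w [h [w_let hG l_dec w_deg]]] := mlist_dec lS.
rewrite {1}l_dec /twist0 twist_act //; apply: memvZ.
have -> : size l = size w by rewrite l_dec size_map size_dec_prefix.
by apply: Phi_span => //; apply: mlist_dec_valid lS w_let w_deg.
Qed.

Lemma isotypic_span m : (isotypic F dbl chi0 m <= <<map Phi (normal n dbl k m)>>)%VS.
Proof. by apply/schains_mlist => l lS <-; apply: twist0_span. Qed.

Lemma dim_isotypic_le m : (\dim (isotypic F dbl chi0 m) <= size (normal n dbl k m))%N.
Proof.
apply: leq_trans (dimvS (isotypic_span m)) _; rewrite -(size_map Phi).
exact: dim_span.
Qed.

Lemma encode_cons a w : encode (a :: w) =
  nseq a.1 true ++ false :: nseq a.2 true ++ false :: encode w.
Proof. by rewrite /encode /= -!catA /= -!catA. Qed.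

Lemma nseq_true_inj i j s t :
  nseq i true ++ false :: s = nseq j true ++ false :: t -> i = j /\ s = t.
Proof. by elim: i j => [|i IH] [|j] //= [] // /IH[-> ->]. Qed.

Lemma encode_inj : injective encode.
Proof.
elim=> [|a u IH] [|b v] //.
- by rewrite encode_cons; case: (b.1).
- by rewrite encode_cons; case: (a.1).
rewrite !encode_cons => /nseq_true_inj[a1 /nseq_true_inj[a2 /IH->]].
by case: a b a1 a2 => [? ?] [? ?] /= -> ->.
Qed.

(** If the dimensions equal the numbers of normal words, these words give bases, and the columns are
    the coordinates of the boundaries of basis elements. *)
Lemma dim_boundary_isotypic (F3 : (3 : F) = 0) m r :
    \dim (isotypic F dbl chi0 m) = size (normal n dbl k m) ->
    \dim (isotypic F dbl chi0 m.+1) = size (normal n dbl k m.+1) ->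
    isotypic_rank n dbl k m = Some r ->
  \dim (bd @: isotypic F dbl chi0 m.+1) = r.
Proof.
set R := normal n dbl k m; set C := normal n dbl k m.+1 => dimR dimC rankE.
have free_Phi j : \dim (isotypic F dbl chi0 j) = size (normal n dbl k j) ->
    (isotypic F dbl chi0 j = <<map Phi (normal n dbl k j)>>)%VS /\ free (map Phi (normal n dbl k j)).
  move=> dimE; have le := dim_span (map Phi (normal n dbl k j)).
  have ge := dimvS (isotypic_span j); rewrite size_map -dimE in le.
  split; first by apply/eqP; rewrite eqEdim isotypic_span le.
  by rewrite /free size_map -dimE eqn_leq le ge.
have [_ freeR] := free_Phi _ dimR; have [-> _] := free_Phi _ dimC.
(* Keys that encode no word of [R] receive a default value; the columns contain none of them. *)
pose vec (x : key) := Phi (nth [::] R (index x (map encode R))).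
have vecE w : w \in R -> vec (encode w) = Phi w.
  by move=> wR; rewrite /vec index_map ?nth_index //; apply: encode_inj.
have mapR : map vec (map encode R) = map Phi R.
  by rewrite -map_comp; apply/eq_in_map => w /vecE.
have Ks_free : free (map vec (map encode R)) by rewrite mapR.
have termR w p : w \in C -> p \in deletion_terms k [::] false w -> meets_below k p.2 -> p.2 \in R.
  move=> /mem_normal[wc wm _] /deletion_terms_mem[u [a [v [E ->]]]] ap.
  apply/mem_normal; split=> //; first by apply: (@canonical_delete _ a); rewrite -E.
  by move: wm; rewrite (_ : w = u ++ a :: v) // !size_cat /= addnS => -[].
have colE w : w \in C -> over (map encode R) (boundary_column k w) /\ ceval vec (boundary_column k w) = bd (Phi w).
  move=> wC; have /mem_normal[/canonical_valid w_val _ _] := wC.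
  have bw p : p \in deletion_terms k [::] false w -> bounded p.2.
    move=> /deletion_terms_mem[u [a [v [E ->]]]]; have [+ _] := w_val.
    rewrite (_ : w = u ++ a :: v) // /bounded !all_cat /=.
    by case/and3P=> -> _ ->.
  rewrite Phi_boundary // /boundary_column.
  have := @termR w ^~ wC; elim: (deletion_terms _ _ _ _) bw => [|p ps IH] bw tR.
    by rewrite big_nil ceval_nil.
  have [|q qps|os Es] := IH; first by move=> q qps; apply: bw; rewrite inE qps orbT.
    by apply: tR; rewrite inE qps orbT.
  rewrite /= big_cons; case: ifP => ap; last first.
    rewrite os Es; split=> //.
    by rewrite Phi_isolated ?ap ?bw ?mem_head // scaler0 add0r.
  have pR : p.2 \in R by apply: tR; rewrite ?mem_head.
  split; first by apply: over_cadd; rewrite //= map_f.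
  by rewrite ceval_cadd // Es ceval_cons ceval_nil /= addr0 expr0 scale1r vecE // addrC.
rewrite limg_span -map_comp.
rewrite (eq_in_map _ (fun w => ceval vec (boundary_column k w)) C).1; last first.
  by move=> w /colE[_ ->].
rewrite (map_comp (ceval vec)).
rewrite (eq_span (Y := map (ceval vec) (rev (map (boundary_column k) C)))); last first.
  by move=> v; rewrite map_rev mem_rev.
apply: (eliminate_dim F3 Ks_free _ rankE).
by apply/allP => c; rewrite mem_rev => /mapP[w /colE[oc _] ->].
Qed.

End Words.

(** * Adding up the ranks over all characters *)

Lemma card_points n0 dbl : #|points n0 dbl| = (n0.+1 * capacity dbl)%N.
Proof.
have -> : points n0 dbl = setX [set: 'I_n0.+1] [set b : bool | b ==> dbl].
  by apply/setP => -[i b]; rewrite !inE.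
rewrite cardsX cardsT card_ord; congr (_ * _)%N.
by case: dbl; rewrite cardsE cardE /enum_mem -enumT enumT unlock.
Qed.

Lemma sum_subsets_card (T : finType) (g : nat -> nat) :
  (\sum_(A : {set T}) g #|A| = \sum_(j < #|T|.+1) 'C(#|T|, j) * g j)%N.
Proof.
rewrite (partition_big (fun A : {set T} => inord #|A| : 'I_#|T|.+1) predT) //=.
apply: eq_bigr => j _; rewrite -(card_draws T j) -sum_nat_const.
have card_lt (A : {set T}) : (#|A| < #|T|.+1)%N by rewrite ltnS max_card.
apply: eq_big => [A|A /eqP <-]; last by rewrite inordK.
by rewrite inE -val_eqE /= inordK.
Qed.

Definition total (n : nat) (dbl : bool) (g : nat -> nat) : nat :=
  if dbl then sumn [seq 'C(n, j) * g j | j <- iota 0 n.+1]%N else g 0%N.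

Lemma sum_chars n0 dbl g :
  (\sum_(chi | chars (n0 := n0) dbl chi) g #|chi| = total n0.+1 dbl g)%N.
Proof.
rewrite /chars /total; case: dbl; last by rewrite /= big_pred1_eq cards0.
rewrite (eq_bigl predT) // sum_subsets_card card_ord sumnE big_map.
by rewrite -(big_mkord xpredT (fun j => 'C(n0.+1, j) * g j)%N) /index_iota subn0.
Qed.

Section Rank.
Variables (F : fieldType) (F2 : (2 : F) != 0) (F3 : (3 : F) = 0).
Variables (n0 : nat) (dbl : bool) (m : nat) (r : nat -> nat).
Local Notation n := n0.+1.
Local Notation K := (matchings (clique (points n0 dbl))).

Hypothesis rankE : forall k, (k <= n)%N -> (k == 0%N) || dbl -> isotypic_rank n dbl k m = Some (r k).
Hypothesis countE : forall j, (m <= j <= m.+1)%N ->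
  total n dbl (fun k => size (normal n dbl k j)) = num_matchings (n * capacity dbl) j.

Lemma chars_card chi : chars (n0 := n0) dbl chi ->
  (#|chi| <= n)%N /\ ((0 < #|chi|)%N -> dbl).
Proof.
move=> chiP; split; first by rewrite -[n in (_ <= n)%N]card_ord max_card.
by move: chiP; rewrite /chars; case: dbl => //= /eqP->; rewrite cards0.
Qed.

Lemma card_chi0 k : (k <= n)%N -> #|chi0 n0 k| = k.
Proof.
move=> kn; have inj : injective (widen_ord kn) by move=> i j /(congr1 val) ij; apply: val_inj.
rewrite -[RHS](card_ord k) -(card_imset _ inj).
apply: eq_card => i; rewrite inE; apply/idP/imsetP => [ik|[j _ ->]]; last exact: (valP j).
by exists (Ordinal ik) => //; apply: val_inj.
Qed.

(** The isotypic parts span a space whose dimension, by [countE], is the sum of the upper bounds on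
    their dimensions. So every bound is attained and the sum is direct. *)
Lemma isotypic_direct j : (m <= j <= m.+1)%N ->
  (forall chi : {set 'I_n}, chars dbl chi -> (\dim (isotypic F dbl chi j) = size (normal n dbl #|chi| j))) /\
  directv (\sum_(chi | chars (n0 := n0) dbl chi) isotypic F dbl chi j).
Proof.
move=> jm.
have le (chi : {set 'I_n}) : chars dbl chi ->
    (\dim (isotypic F dbl chi j) <= size (normal n dbl #|chi| j) ?= iff
       (\dim (isotypic F dbl chi j) == size (normal n dbl #|chi| j)))%N.
  move=> /chars_card[chi_n chi_dbl]; split=> //.
  have [chi_le _] := dim_isotypic_card F dbl j (esym (card_chi0 chi_n) : #|chi| = #|chi0 n0 #|chi| |).
  by apply: leq_trans chi_le _; apply: dim_isotypic_le.
have [sum_le sum_eq] := leqif_sum le.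
have dimE : \dim (\sum_(chi | chars (n0 := n0) dbl chi) isotypic F dbl chi j) =
    (\sum_(chi | chars (n0 := n0) dbl chi) size (normal n dbl #|chi| j))%N.
  rewrite isotypic_sum // dim_schains card_matchings card_points -countE //.
  by rewrite -(sum_chars n0 dbl (fun k => size (normal n dbl k j))).
have dim_le := dimv_leq_sum (index_enum _) (chars (n0 := n0) dbl) (fun chi => isotypic F dbl chi j).
split; last by rewrite directvEgeq /= dimE.
move: sum_eq; rewrite eqn_leq sum_le -dimE dim_le /= => /esym/forall_inP all_eq.
by move=> chi /all_eq/eqP.
Qed.

(** The boundary maps each isotypic part into the one with the same character one size lower. As the
    latter are independent, so are the images, and their dimensions add up. *)
Lemma rank_isotypic : rank F K m.+1 = total n dbl r.
Proof.
have mm : (m <= m <= m.+1)%N by rewrite leqnn leqnSn.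
have [_ direct_m] := isotypic_direct mm.
have Ubd (chi : {set 'I_n}) : (boundary F _ @: isotypic F dbl chi m.+1 <= isotypic F dbl chi m)%VS.
  rewrite -limg_comp; apply/schains_mlist => l lS lm; rewrite comp_lfunE twist_boundary.
  apply: memv_img; apply: (subvP (boundary_schains F m (@matchings_closed _ _))).
  by apply: memv_img; rewrite -lm osimp_schains.
rewrite /rank -(isotypic_sum F2 n0 dbl) limg_sum.
have : directv (\sum_(chi | chars (n0 := n0) dbl chi)
    (boundary F _ @: isotypic F dbl chi m.+1)%VS).
  apply/directv_sum_independent => us usU; apply: (directv_sum_independent direct_m).
  by move=> chi chiP; apply: (subvP (Ubd chi)); apply: usU.
rewrite directvE => /eqP ->.
rewrite /= -sum_chars; apply: eq_bigr => chi chiP.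
have [chi_n chi_dbl] := chars_card chiP.
have card_eq := card_chi0 chi_n.
have E0 j : (m <= j <= m.+1)%N ->
    \dim (isotypic F dbl (chi0 n0 #|chi|) j) = size (normal n dbl #|chi| j).
  move=> jm; rewrite (isotypic_direct jm).1 ?card_eq //.
  by move: chiP chi_n; rewrite /chars; case: dbl => //= /eqP-> _; rewrite cards0;
     apply/eqP/setP => i; rewrite !inE.
have -> : \dim (boundary F _ @: isotypic F dbl chi m.+1) =
    \dim (boundary F _ @: isotypic F dbl (chi0 n0 #|chi|) m.+1).
  apply/eqP; rewrite eqn_leq (dim_isotypic_card F dbl m.+1 card_eq).2.
  by rewrite (dim_isotypic_card F dbl m.+1 (esym card_eq)).2.
apply: (dim_boundary_isotypic F2 chi_n chi_dbl F3); rewrite ?E0 ?leqnn ?leqnSn //.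
by apply: rankE => //; case: posnP => // /chi_dbl->.
Qed.

End Rank.

(** * Exact values *)

Definition rank_check (n : nat) (dbl : bool) (m : nat) (rs : seq nat) : bool :=
  all (fun k => isotypic_rank n dbl k m == Some (nth 0%N rs k)) (iota 0 (if dbl then n.+1 else 1)) &&
  all (fun j => total n dbl (fun k => size (normal n dbl k j)) == num_matchings (n * capacity dbl) j)
    [:: m; m.+1].

Lemma rank_of_check (F : fieldType) (V : finType) (S : {set V}) n0 dbl m rs :
    (2 : F) != 0 -> (3 : F) = 0 -> #|S| = (n0.+1 * capacity dbl)%N ->
    rank_check n0.+1 dbl m rs ->
  rank F (matchings (clique S)) m.+1 = total n0.+1 dbl (nth 0%N rs).
Proof.
move=> F2 F3 Sn /andP[/allP chk /allP cnt].
have cap0 : (0 < capacity dbl)%N by case: (dbl).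
rewrite (rank_clique F m.+1 (_ : #|S| = #|points n0 dbl|)) ?card_points ?Sn ?muln_gt0 //.
apply: rank_isotypic => // [k kn kd|j jm].
  by apply/eqP/chk; rewrite mem_iota /=; move: kd; case: (dbl) => //= /orP[/eqP->|].
apply/eqP/cnt; rewrite !inE; lia.
Qed.

Section Values.
Variables (F : fieldType) (F2 : (2 : F) != 0) (F3 : (3 : F) = 0) (V : finType).
Implicit Types S : {set V}.

(** In the vanishing range [rank_le_faces] becomes an equality, which determines the ranks
    successively from [rank1]. *)
Lemma rank_add S m : (3 * m.+1 <= #|S| + 1)%N ->
  (rank F (matchings (clique S)) m + rank F (matchings (clique S)) m.+1 = num_matchings #|S| m)%N.
Proof.
move=> Sm; have [/(_ S Sm)/eqP + _] := betti_vanish F V m.+1.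
rewrite /betti subn_eq0 card_matchings => ge; apply/eqP; rewrite eqn_leq ge andbT.
by rewrite -card_matchings rank_le_faces //; apply: matchings_closed.
Qed.

Lemma rank1 S : (2 <= #|S|)%N -> rank F (matchings (clique S)) 1 = 1%N.
Proof.
move=> S2; have := @rank_add S 0; rewrite rank0 add0n => ->; last by lia.
by case: #|S|.
Qed.

End Values.

Lemma rank_check3 : rank_check 3 false 1 [:: 0%N]. Proof. by vm_compute. Qed.
Lemma rank_check6 : rank_check 6 false 2 [:: 15]. Proof. by vm_compute. Qed.
Lemma rank_check7 : rank_check 7 false 2 [:: 84]. Proof. by vm_compute. Qed.
Lemma rank_check9 : rank_check 9 false 3 [:: 867]. Proof. by vm_compute. Qed.

(* The boundary out of the 5-edge matchings of [M_12] would be too large to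
   eliminate in one piece; entry [k] is its rank on the part of a character
   nontrivial at [k] of the six nodes. *)
Lemma rank_check12 : rank_check 6 true 4 [:: 1020; 930; 778; 605; 457; 335; 244].
Proof. by vm_compute. Qed.

Section Values3.
Local Notation F := 'F_3.
Variable V : finType.
Implicit Types S : {set V}.

Let F2 : (2 : F) != 0. Proof. by []. Qed.
Let F3 : (3 : F) = 0. Proof. exact/val_inj. Qed.

Lemma betti3 S : #|S| = 3%N -> betti F (clique S) 2 = 2%N.
Proof.
move=> S3; have r2 := rank_of_check F2 F3 (n0 := 2) (dbl := false) S3 rank_check3.
by rewrite /betti card_matchings r2 rank1 ?S3.
Qed.

(** The rank of size 2 is 15 - 1 = 14, and 45 - 14 - 15 = 16. *)
Lemma betti6 S : #|S| = 6%N -> betti F (clique S) 3 = 16%N.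
Proof.
move=> S6; have r3 := rank_of_check F2 F3 (n0 := 5) (dbl := false) S6 rank_check6.
have r12 := @rank_add F V S 1; rewrite rank1 ?S6 // in r12.
rewrite /betti card_matchings r3 S6; move: r12 => /(_ isT) /=; lia.
Qed.

(** Here 105 - (21 - 1) - 84 = 1; this is the base case for [betti_le1]. *)
Lemma betti7 S : #|S| = 7%N -> betti F (clique S) 3 = 1%N.
Proof.
move=> S7; have r3 := rank_of_check F2 F3 (n0 := 6) (dbl := false) S7 rank_check7.
have r12 := @rank_add F V S 1; rewrite rank1 ?S7 // in r12.
rewrite /betti card_matchings r3 S7; move: r12 => /(_ isT) /=; lia.
Qed.

(** The ranks of sizes 2 and 3 are 35 and 343, and 1260 - 343 - 867 = 50. *)
Lemma betti9 S : #|S| = 9%N -> betti F (clique S) 4 = 50%N.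
Proof.
move=> S9; have r4 := rank_of_check F2 F3 (n0 := 8) (dbl := false) S9 rank_check9.
have r12 := @rank_add F V S 1; rewrite rank1 ?S9 // in r12.
have r23 := @rank_add F V S 2; rewrite ?S9 // in r23.
have c1 : num_matchings 9 1 = 36 by [].
have c2 : num_matchings 9 2 = 378 by [].
have c3 : num_matchings 9 3 = 1260 by [].
rewrite /betti card_matchings r4 S9 c3.
by move: r12 r23 => /(_ isT) + /(_ isT); rewrite c1 c2 /=; lia.
Qed.

(** The ranks of sizes 2, 3 and 4 are 65, 1420 and 12440, and 51975 - 12440 - 39479 = 56. *)
Lemma betti12 S : #|S| = 12%N -> betti F (clique S) 5 = 56%N.
Proof.
move=> S12; have r5 := rank_of_check F2 F3 (n0 := 5) (dbl := true) S12 rank_check12.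
have r12 := @rank_add F V S 1; rewrite rank1 ?S12 // in r12.
have r23 := @rank_add F V S 2; rewrite ?S12 // in r23.
have r34 := @rank_add F V S 3; rewrite ?S12 // in r34.
have c1 : num_matchings 12 1 = 66 by [].
(* Each product is the number of choices of the covered points times the number of perfect matchings
   on them. *)
have /eqP c2 : num_matchings 12 2 == (495 * 3)%N by vm_compute.
have /eqP c3 : num_matchings 12 3 == (924 * 15)%N by vm_compute.
have /eqP c4 : num_matchings 12 4 == (495 * 105)%N by vm_compute.
have /eqP t : total 6 true (nth 0%N [:: 1020; 930; 778; 605; 457; 335; 244]) ==
  (1020 + 6 * 930 + 15 * 778 + 20 * 605 + 15 * 457 + 6 * 335 + 244)%N by vm_compute.
rewrite c1 in r12; rewrite c2 in r23; rewrite c3 in r34.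
rewrite /betti card_matchings r5 S12 c4 t.
by move: r12 r23 r34 => /(_ isT) r12 /(_ isT) r23 /(_ isT) r34; lia.
Qed.

End Values3.

(** * Translation to [beta] and conclusion *)

Lemma beta_betti n d : beta n d = betti 'F_3 (clique [set: 'I_n]) d.+2.
Proof.
have -> : clique [set: 'I_n] = complete_edges n by apply/setP => e; rewrite !inE subsetT.
by rewrite /beta reduced_bettiE /betti subnDA.
Qed.

Theorem theorem5p15 :
  [/\ beta 3 0 = 2%N, beta 6 1 = 16%N, beta 9 2 = 50%N, beta 12 3 = 56%N
    & forall r : nat, (4 <= r)%N ->
        (beta (3 * r + 3) r)%:R
          <= (6 * r%:R ^+ 3 + 9 * r%:R ^+ 2 + 5 * r%:R) / 2 - 73 :> rat].
Proof.
split=> [||||r r4]; rewrite beta_betti.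
- by rewrite betti3 // cardsT card_ord.
- by rewrite betti6 // cardsT card_ord.
- by rewrite betti9 // cardsT card_ord.
- by rewrite betti12 // cardsT card_ord.
have base7 (S : {set 'I_(3 * r + 3)}) : #|S| = 7%N -> (betti 'F_3 (clique S) 3 <= 1)%N.
  by move/betti7->.
have base12 (S : {set 'I_(3 * r + 3)}) : #|S| = 12%N -> (betti 'F_3 (clique S) 5 <= 56)%N.
  by move/betti12->.
have := betti_cubic_bound base7 base12 (ltnW r4) (S := [set: _]).
rewrite cardsT card_ord => /(_ erefl); set h := betti _ _ _.
rewrite -(ler_nat rat) !natrD !natrM; lra.
Qed.
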